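(* Let $V$ be a $d$-dimensional vector space over a field $\mathbb{F}_p$ of prime order $p$, and let $g=t_vh$ (with $v\in V$, $h\in\mathrm{GL}(V)$) be an affine transformation of $V$ with at most four cycles in its action on $V$. Then, up to conjugacy, $g$ is one of the following elements, with $|g|$ and the cycle lengths on $V$ as stated. Arbitrary $p$: (A1) $d\ge1$, $g=s_d^i$ with $1\le i\le3$, $i\mid p^d-1$; $|g|=|h|$; $i+1$ cycles: one of length $1$ and $i$ of length $\frac{p^d-1}{i}$. (A2) $d=2$, $g=s_1\otimes J_2$; $|g|=|h|$; cycle lengths $1,\,p-1,\,p(p-1)$. (A3) $d=1$, $g=t_{e_1}$; $|g|=p|h|$; one cycle of length $p$. (A4) $d\ge2$, $g=t_{e_1}(J_1\oplus s_{d-1}^i)$ with $1\le i\le3$, $i\mid p^{d-1}-1$; $|g|=p|h|$; $i+1$ cycles: one of length $p$ and $i$ of length $\frac{p(p^{d-1}-1)}{i}$. Other infinite families, $p=2$: (B1) $d\ge3$, $g=s_{a_1}\oplus s_{a_2}$ with $\gcd(a_1,a_2)=1$, $d=a_1+a_2$; $|g|=|h|$; cycle lengths $1,\,2^{a_1}-1,\,2^{a_2}-1,\,(2^{a_1}-1)(2^{a_2}-1)$. (B2) $d\ge3$, $g=J_1\oplus s_{d-1}$; $|g|=|h|$; cycle lengths $1,1,2^{d-1}-1,2^{d-1}-1$. (B3) $d\ge5$, $g=t_{e_1}(J_3\oplus s_{d-3})$; $|g|=|h|$; cycle lengths $4,4,2^{d-1}-4,2^{d-1}-4$. (B4) $d\ge4$,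 $g=t_{e_1}(J_1\oplus J_1\oplus s_{d-2})$; $|g|=2|h|$; cycle lengths $2,2,2^{d-1}-2,2^{d-1}-2$. (B5) $d\ge4$, $g=t_{e_1}(J_2\oplus s_{d-2}^i)$ with $i\in\{1,3\}$, and $d$ even if $i=3$; $|g|=2|h|$; $i+1$ cycles: one of length $4$ and $i$ of length $\frac{2^d-4}{i}$. (B6) $d\ge5$, $g=t_{e_1}(J_2\oplus J_1\oplus s_{d-3})$; $|g|=2|h|$; cycle lengths $4,4,2^{d-1}-4,2^{d-1}-4$. (B7) $d\ge6$, $g=t_{e_1}(J_a\oplus s_{a_1}\oplus s_{a_2})$ with $1\le a\le2\le a_1<a_2$, $\gcd(a_1,a_2)=1$, $d=a+a_1+a_2$; $|g|=2|h|$; cycle lengths $2^a,\,2^a(2^{a_1}-1),\,2^a(2^{a_2}-1),\,2^a(2^{a_1}-1)(2^{a_2}-1)$. (B8) $d\ge6$, $g=t_{e_1}(J_4\oplus s_{d-4})$; $|g|=2|h|$; cycle lengths $8,8,2^{d-1}-8,2^{d-1}-8$. Sporadic cases: (C1) $d=2$, $p\in\{2,3\}$, $g=t_{e_1}$; $|g|=p|h|$; $p$ cycles of length $p$. (C2) $d=2$, $p=3$, $g=t_{e_1}J_2$; $|g|=|h|$; $3,3,3$. (C3) $d=3$, $p=2$, $g=t_{e_1}J_3$; $|g|=|h|$; $4,4$. (C4) $d=3$, $p=2$, $g=t_{e_3}(J_2\oplus J_1)$; $|g|=|h|$; $2,2,2,2$. (C5) $d=3$, $p=2$, $g=J_3$;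 $|g|=|h|$; $1,1,2,4$. (C6) $d=4$, $p=2$, $g=t_{e_1}(J_3\oplus J_1)$; $|g|=|h|$; $4,4,4,4$. (C7) $d=4$, $p=2$, $g=s_2\otimes J_2$; $|g|=|h|$; $1,3,6,6$. (C8) $d=5$, $p=2$, $g=t_{e_1}J_5$; $|g|=|h|$; $8,8,8,8$. (C9) $d=2$, $p=2$, $g=t_{e_1}J_2$; $|g|=p|h|$; $4$. (C10) $d=3$, $p=2$, $g=t_{e_1}$; $|g|=p|h|$; $2,2,2,2$. (C11) $d=3$, $p=2$, $g=t_{e_1}(J_2\oplus J_1)$; $|g|=p|h|$; $4,4$. (C12) $d=3$, $p=3$, $g=t_{e_1}J_3$; $|g|=p|h|$; $9,9,9$. (C13) $d=4$, $p=2$, $g=t_{e_1}(J_2\oplus J_2)$ or $t_{e_1}(J_2\oplus J_1\oplus J_1)$; $|g|=p|h|$; $4,4,4,4$. (C14) $d=4$, $p=2$, $g=t_{e_1}J_4$; $|g|=p|h|$; $8,8$. (C15) $d=5$, $p=2$, $g=t_{e_1}(J_4\oplus J_1)$; $|g|=p|h|$; $8,8,8,8$.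
   Context: $V=\mathbb{F}_p^d$ is the space of row vectors with basis $e_1,\dots,e_d$; maps act on the right. Every affine transformation of $V$ is uniquely $g=t_vh$, where $t_v:x\mapsto x+v$ is a translation, $h\in\mathrm{GL}(V)$, and $t_v$ is performed first, so $xg=(x+v)h$. $|g|$ denotes the order of $g$. The number of cycles is counted over all of $V$, including fixed points and the zero vector. Conjugacy is in the affine group $\mathrm{AGL}(V)$. For each $j\ge1$, $s_j$ denotes a generator of a Singer cycle in $\mathrm{GL}_j(p)$, that is, an element of order $p^j-1$; not all such elements are conjugate, so an item containing $s_j$ may represent several conjugacy classes. $J_j\in\mathrm{GL}_j(p)$ is the cyclic unipotent element (single $j\times j$ Jordan block with eigenvalue 1) mapping $e_i$ to $e_i+e_{i+1}$ for $i<j$ and fixing $e_j$. $A\oplus B$ is the block diagonal sum, with the blocks acting successively on consecutive basis vectors (so $J_j\oplus J_i$ acts as $J_j$ on $\langle e_1,\dots,e_j\rangle$ and as $J_i$ on $\langle e_{j+1},\dots,e_{j+i}\rangle$), and $A\otimes B$ is the tensor (Kronecker) product. *)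

(* Defs.v *)
From mathcomp Require Import all_boot all_fingroup all_algebra.
From mathcomp Require Import mxtens.

Set Implicit Arguments.
Unset Strict Implicit.
Unset Printing Implicit Defensive.

Import GroupScope GRing.Theory.

Local Open Scope nat_scope.

(* Maps act on row vectors from the right: in {perm V}, [s * t] applies [s]   *)
(* first, so [transl v * lin h] is t_v h, i.e. x |-> (x + v) h.               *)

Definition transl (p d : nat) (v : 'rV['F_p]_d) : {perm 'rV['F_p]_d} :=
  perm (addIr v).

(* Meaningful for invertible h only; the identity by convention otherwise.    *)
Definition lin (p d : nat) (h : 'M['F_p]_d) : {perm 'rV['F_p]_d} :=
  insubd (1%g : {perm 'rV['F_p]_d}) [ffun x : 'rV['F_p]_d => (x *m h)%R].

Lemma linE (p d : nat) (h : 'M['F_p]_d) (x : 'rV['F_p]_d) :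
  h \in unitmx -> lin h x = (x *m h)%R.
Proof.
move=> hU; rewrite /lin -pvalE val_insubd.
have -> : injectiveb [ffun x : 'rV['F_p]_d => (x *m h)%R].
  by apply/injectiveP => y z; rewrite !ffunE => /(can_inj (mulmxK hU)).
by rewrite ffunE.
Qed.

Lemma affineE (p d : nat) (v : 'rV['F_p]_d) (h : 'M['F_p]_d) (x : 'rV['F_p]_d) :
  h \in unitmx -> (transl v * lin h)%g x = ((x + v) *m h)%R.
Proof. by move=> hU; rewrite permM permE linE. Qed.

Definition AGL (p d : nat) : {set {perm 'rV['F_p]_d}} :=
  [set (transl v * lin h)%g | v in 'rV['F_p]_d, h in @unitmx 'F_p d].

(* Fixed points are included, as cycles of length 1.                          *)
Definition cycle_lengths (T : finType) (g : {perm T}) : seq nat :=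
  [seq #|(X : {set T})| | X <- enum (porbits g)].

(* e_k, with k counted from 1. *)
Definition e_ (p d k : nat) : 'rV['F_p]_d :=
  (\row_(j < d) (j.+1 == k)%:R)%R.

(* J_n; row i is the image e_i + e_(i+1) of e_i (e_i if i is last). *)
Definition J (p n : nat) : 'M['F_p]_n :=
  (\matrix_(i, j) ((j == i :> nat) || (j == i.+1 :> nat))%:R)%R.

Definition dsum (p m n : nat) (A : 'M['F_p]_m) (B : 'M['F_p]_n) :
  'M['F_p]_(m + n) := block_mx A 0%R 0%R B.

Definition singer (p j : nat) (s : 'M['F_p]_j) : Prop :=
  [/\ 0 < j, s \in unitmx & #[lin s]%g = p ^ j - 1].

(* [classified v h c l]: the element t_v h of AGL_d(p) is in the list, with   *)
(* |t_v h| = c |h| and with l as its stated list of cycle lengths.  The       *)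
(* dimension d is an index, so that block sums need no cast.                  *)
Inductive classified :
  forall p d : nat, 'rV['F_p]_d -> 'M['F_p]_d -> nat -> seq nat -> Prop :=
| A1 p d i (s : 'M['F_p]_d) :
    1 <= d -> 1 <= i <= 3 -> i %| p ^ d - 1 -> singer s ->
    classified 0%R (s ^+ i)%R 1 (1 :: nseq i ((p ^ d - 1) %/ i))
| A2 p (s : 'M['F_p]_1) :
    singer s ->
    classified 0%R (s *t J p 2)%R 1 [:: 1; p - 1; p * (p - 1)]
| A3 p :
    classified (e_ p 1 1) 1%:M%R p [:: p]
| A4 p m i (s : 'M['F_p]_m) : let d := 1 + m in
    2 <= d -> 1 <= i <= 3 -> i %| p ^ (d - 1) - 1 -> singer s ->
    classified (e_ p d 1) (dsum (J p 1) (s ^+ i)%R) p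
      (p :: nseq i ((p * (p ^ (d - 1) - 1)) %/ i))
| B1 a1 a2 (s1 : 'M['F_2]_a1) (s2 : 'M['F_2]_a2) : let d := a1 + a2 in
    3 <= d -> gcdn a1 a2 = 1 -> singer s1 -> singer s2 ->
    @classified 2 d 0%R (dsum s1 s2) 1
      [:: 1; 2 ^ a1 - 1; 2 ^ a2 - 1; (2 ^ a1 - 1) * (2 ^ a2 - 1)]
| B2 m (s : 'M['F_2]_m) : let d := 1 + m in
    3 <= d -> singer s ->
    @classified 2 d 0%R (dsum (J 2 1) s) 1
      [:: 1; 1; 2 ^ (d - 1) - 1; 2 ^ (d - 1) - 1]
| B3 m (s : 'M['F_2]_m) : let d := 3 + m in
    5 <= d -> singer s ->
    classified (e_ 2 d 1) (dsum (J 2 3) s) 1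
      [:: 4; 4; 2 ^ (d - 1) - 4; 2 ^ (d - 1) - 4]
| B4 m (s : 'M['F_2]_m) : let d := 1 + 1 + m in
    4 <= d -> singer s ->
    classified (e_ 2 d 1) (dsum (dsum (J 2 1) (J 2 1)) s) 2
      [:: 2; 2; 2 ^ (d - 1) - 2; 2 ^ (d - 1) - 2]
| B5 m (i : nat) (s : 'M['F_2]_m) : let d := 2 + m in
    4 <= d -> i \in [:: 1; 3] -> (i = 3 -> ~~ odd d) -> singer s ->
    classified (e_ 2 d 1) (dsum (J 2 2) (s ^+ i)%R) 2
      (4 :: nseq i ((2 ^ d - 4) %/ i))
| B6 m (s : 'M['F_2]_m) : let d := 2 + 1 + m in
    5 <= d -> singer s ->
    classified (e_ 2 d 1) (dsum (dsum (J 2 2) (J 2 1)) s) 2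
      [:: 4; 4; 2 ^ (d - 1) - 4; 2 ^ (d - 1) - 4]
| B7 a a1 a2 (s1 : 'M['F_2]_a1) (s2 : 'M['F_2]_a2) : let d := a + a1 + a2 in
    6 <= d -> 1 <= a <= 2 -> 2 <= a1 -> a1 < a2 -> gcdn a1 a2 = 1 ->
    singer s1 -> singer s2 ->
    classified (e_ 2 d 1) (dsum (dsum (J 2 a) s1) s2) 2
      [:: 2 ^ a; 2 ^ a * (2 ^ a1 - 1); 2 ^ a * (2 ^ a2 - 1);
          2 ^ a * (2 ^ a1 - 1) * (2 ^ a2 - 1)]
| B8 m (s : 'M['F_2]_m) : let d := 4 + m in
    6 <= d -> singer s ->
    classified (e_ 2 d 1) (dsum (J 2 4) s) 2
      [:: 8; 8; 2 ^ (d - 1) - 8; 2 ^ (d - 1) - 8]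
| C1 (p : nat) :
    p \in [:: 2; 3] -> classified (e_ p 2 1) 1%:M%R p (nseq p p)
| C2 : classified (e_ 3 2 1) (J 3 2) 1 [:: 3; 3; 3]
| C3 : classified (e_ 2 3 1) (J 2 3) 1 [:: 4; 4]
| C4 : classified (e_ 2 3 3) (dsum (J 2 2) (J 2 1)) 1 [:: 2; 2; 2; 2]
| C5 : @classified 2 3 0%R (J 2 3) 1 [:: 1; 1; 2; 4]
| C6 : classified (e_ 2 4 1) (dsum (J 2 3) (J 2 1)) 1 [:: 4; 4; 4; 4]
| C7 (s : 'M['F_2]_2) :
    singer s -> @classified 2 4 0%R (s *t J 2 2)%R 1 [:: 1; 3; 6; 6]
| C8 : classified (e_ 2 5 1) (J 2 5) 1 [:: 8; 8; 8; 8]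
| C9 : classified (e_ 2 2 1) (J 2 2) 2 [:: 4]
| C10 : classified (e_ 2 3 1) 1%:M%R 2 [:: 2; 2; 2; 2]
| C11 : classified (e_ 2 3 1) (dsum (J 2 2) (J 2 1)) 2 [:: 4; 4]
| C12 : classified (e_ 3 3 1) (J 3 3) 3 [:: 9; 9; 9]
| C13a : classified (e_ 2 4 1) (dsum (J 2 2) (J 2 2)) 2 [:: 4; 4; 4; 4]
| C13b :
    classified (e_ 2 4 1) (dsum (dsum (J 2 2) (J 2 1)) (J 2 1)) 2
      [:: 4; 4; 4; 4]
| C14 : classified (e_ 2 4 1) (J 2 4) 2 [:: 8; 8]
| C15 : classified (e_ 2 5 1) (dsum (J 2 4) (J 2 1)) 2 [:: 8; 8; 8; 8].

(* Main.v *)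
(* Let N = h - 1.  After moving the origin, t_v h is t_{e_1} (J_k + h') with h'
   linear (k = 0 exactly when there is a fixed point), where k is the least
   exponent such that (v + y N) N^k = 0 for some y.  All cycles of t_{e_1} J_k
   have the length p^e, where p^e is the least power of p above k, and the cycles
   of a direct product are read off from gcds and lcms of lengths; so k is small
   and h' has at most four cycles.

   Let h' have at most three cycles on nonzero vectors.  If two
   nonzero stable subspaces meet in 0, they and their sum use up all the cycles,
   which forces two Singer cycles of coprime degrees over F_2 (or the identity
   of F_2^2).  Otherwise there is a least nonzero stable subspace S.  If S is
   everything, the centralizer of h' is a field and h' is a power of a Singer
   cycle.  If S is a maximal stable subspace, let n be the order of h' on S:
   then h'^n - 1 maps V / S isomorphically onto S, and counting vectors leaves
   a scalar multiple of J_2 and, over F_2, s_2 (x) J_2.  If S < T < V, each of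
   the three layers is a single cycle, which leaves J_3 over F_2. *)

Require Import Defs.
From mathcomp Require Import all_boot all_fingroup all_algebra.
From mathcomp Require Import cyclic mxabelem mxtens zify.

Set Implicit Arguments.
Unset Strict Implicit.
Unset Printing Implicit Defensive.

Import GroupScope GRing.Theory.

Local Open Scope nat_scope.

(** No normal form of matrices is used: [h] is studied through its stable subspaces only. The link
    to cycles is that the vectors whose cycle length divides [n] form the stable space
    [kermx (h ^+ n - 1)]. A least or a maximal stable subspace therefore forces one length on a
    whole layer, and the size of a layer becomes the equation (number of cycles) times (length),
    with at most three cycles left for the nonzero vectors.

    The factor [c] in |g| = c |h| comes from an off-by-one: [J p k] has order the least power of [p]
    that is at least [k], whereas the cycles of t_{e_1} J_k have as length the least power above
    [k]. The two differ, by a factor [p], exactly when [k] is a power of [p]; the factor is lost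
    when [p] already divides the order of h', as in C4.

    The bound on [k] comes from the number p^(k-e) of cycles of t_{e_1} J_k, where p^(e-1) <= k: it
    exceeds 4 for all but a few [k]. *)

(** * Cycle lengths of permutations *)

Section PermCycles.

Variable T : finType.
Implicit Types (g : {perm T}) (x y : T) (L : seq nat).

(** The interface to orbit lengths: a number is determined by its multiples, so equalities between
    lengths and orders are proved with [eq_dvdn] by comparing the powers of [g] that fix a point. *)
Lemma expg_fixP g x n : reflect ((g ^+ n) x = x) (#|porbit g x| %| n).
Proof.
have per m : (g ^+ (m * #|porbit g x|)) x = x.
  elim: m => [|m IHm]; first by rewrite mul0n expg0 perm1.
  by rewrite mulSn addnC expgD permM IHm permX iter_porbit.
apply: (iffP idP) => [/dvdnP[m ->] // | fix_n].
have c_gt0 : 0 < #|porbit g x| by rewrite lt0n card_porbit_neq0.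
have fix_r : (g ^+ (n %% #|porbit g x|)) x = x.
  rewrite -[RHS]fix_n [in RHS](divn_eq n #|porbit g x|) expgD permM.
  by rewrite per.
have r_lt := ltn_pmod n c_gt0.
have nth_x i : i < #|porbit g x| ->
  nth x (traject g x #|porbit g x|) i = (g ^+ i) x.
  by move=> lt_i; rewrite nth_traject // permX.
apply/eqP; have /uniqP-/(_ x) inj := uniq_traject_porbit g x.
apply: inj; rewrite ?inE ?size_traject // !nth_x //.
by rewrite fix_r expg0 perm1.
Qed.

Lemma card_porbit_gt0 g x : 0 < #|porbit g x|.
Proof. by rewrite lt0n card_porbit_neq0. Qed.

Lemma order_dvd_porbitP g n :
  reflect (forall x, #|porbit g x| %| n) (#[g] %| n).
Proof.
rewrite order_dvdn; apply: (iffP eqP) => [gn1 x | dvd].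
  by apply/expg_fixP; rewrite gn1 perm1.
by apply/permP => x; rewrite perm1; apply/expg_fixP.
Qed.

Lemma eq_dvdn m n : (forall k, (m %| k) = (n %| k)) -> m = n.
Proof. by move=> eq_mn; apply/eqP; rewrite eqn_dvd eq_mn dvdnn -eq_mn dvdnn. Qed.

Lemma size_cycle_lengths g : size (cycle_lengths g) = #|porbits g|.
Proof. by rewrite size_map -cardE. Qed.

Lemma cycle_lengths_sum g (f : nat -> nat) :
  \sum_x f #|porbit g x| = \sum_(l <- cycle_lengths g) l * f l.
Proof.
rewrite big_map big_enum /=.
rewrite (partition_big (porbit g) (mem (porbits g))) /=; last first.
  by move=> x _; apply/imsetP; exists x.
apply: eq_bigr => _ /imsetP[y _ ->].
rewrite (eq_bigr (fun=> f #|porbit g y|)) => [|x /eqP-> //].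
rewrite sum_nat_const; congr (_ * _); apply: eq_card => x.
exact: eq_porbit_mem.
Qed.

Lemma cycle_lengths_gt0 g : all (leq 1) (cycle_lengths g).
Proof.
by apply/allP => _ /mapP[X /[!mem_enum] /imsetP[x _ ->] ->]; apply: card_porbit_gt0.
Qed.

Lemma sum_count_mem (L : seq nat) k :
  \sum_(l <- L) l * (l == k) = k * count_mem k L.
Proof.
elim: L => [|l L IHL]; first by rewrite big_nil muln0.
rewrite big_cons IHL /= mulnDr; congr (_ + _).
by case: eqP => [-> //|]; rewrite !muln0.
Qed.

(** Taking for [f] the indicator of [k] yields [k] times the multiplicity of [k]. The multiplicity
    of 0 is invisible to such sums, hence the positivity hypotheses. *)
Lemma perm_eq_weighted_sum (L1 L2 : seq nat) :
    all (leq 1) L1 -> all (leq 1) L2 ->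
    (forall f : nat -> nat, \sum_(l <- L1) l * f l = \sum_(l <- L2) l * f l) ->
  perm_eq L1 L2.
Proof.
move=> /allP pos1 /allP pos2 eqs; apply/allP => k _ /=; apply/eqP.
have := eqs (fun l => nat_of_bool (l == k)); rewrite !sum_count_mem.
case: (posnP k) => [-> _|k_gt0 /eqP]; last by rewrite eqn_pmul2l // => /eqP.
have not0 L : {in L, forall l, 0 < l} -> count_mem 0 L = 0.
  by move=> pos; apply/count_memPn/negP => /pos.
by rewrite !not0.
Qed.

Lemma perm_cycle_lengths g L :
    all (leq 1) L ->
    (forall f : nat -> nat, \sum_x f #|porbit g x| = \sum_(l <- L) l * f l) ->
  perm_eq (cycle_lengths g) L.
Proof.
move=> posL sumL; apply: perm_eq_weighted_sum (cycle_lengths_gt0 g) posL _ => f.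
by rewrite -cycle_lengths_sum.
Qed.

Lemma sum_perm_cycle_lengths g L (f : nat -> nat) :
    perm_eq (cycle_lengths g) L ->
  \sum_x f #|porbit g x| = \sum_(l <- L) l * f l.
Proof. by move=> /(perm_big _) <-; rewrite cycle_lengths_sum. Qed.

Lemma dvdn_biglcm (L : seq nat) n :
  (\big[lcmn/1]_(l <- L) l %| n) = all (dvdn^~ n) L.
Proof.
elim: L => [|l L IHL]; first by rewrite big_nil dvd1n.
by rewrite big_cons dvdn_lcm IHL.
Qed.

Lemma order_cycle_lengths g L :
  perm_eq (cycle_lengths g) L -> #[g] = \big[lcmn/1]_(l <- L) l.
Proof.
move=> permL; apply: eq_dvdn => n; rewrite dvdn_biglcm -(perm_all _ permL).
apply/order_dvd_porbitP/allP => [dvd _ /mapP[X + ->] | dvd x].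
  by rewrite mem_enum => /imsetP[x _ ->]; apply: dvd.
by apply: dvd; apply/mapP; exists (porbit g x); rewrite // mem_enum imset_f.
Qed.

Lemma invariant_porbit (C : eqType) (c : T -> C) g :
  (forall x, c (g x) = c x) -> forall x y, y \in porbit g x -> c y = c x.
Proof.
move=> inv x y /porbitP[i ->]; elim: i => [|i IHi]; first by rewrite expg0 perm1.
by rewrite expgSr permM inv.
Qed.

Lemma uniq_map_inj (A B : eqType) (f : A -> B) (s : seq A) :
  uniq (map f s) -> {in s &, injective f}.
Proof.
elim: s => //= z s IHs /andP[z_s Us] x y.
rewrite !inE => /predU1P[-> | xs] /predU1P[-> | ys] // eqf; last exact: IHs.
  by case/negP: z_s; rewrite eqf map_f.
by case/negP: z_s; rewrite -eqf map_f.
Qed.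

Lemma invariant_porbits (C : eqType) (c : T -> C) g (s : seq T) :
    (forall x, c (g x) = c x) -> uniq (map c s) ->
  size s <= #|porbits g|.
Proof.
move=> inv Us; rewrite -(size_map (porbit g)) cardE.
apply: uniq_leq_size => [|X /mapP[x _ ->]]; last by rewrite mem_enum imset_f.
rewrite map_inj_in_uniq; first exact: map_uniq Us.
move=> x y xs ys /eqP; rewrite eq_porbit_mem => /(invariant_porbit inv).
exact: uniq_map_inj Us _ _ xs ys.
Qed.

(** Distinct values of an invariant lie in distinct cycles; once as many values are exhibited as
    there are cycles, the invariant is complete. The bound of four cycles is exploited in this
    way. *)
Lemma invariant_separates (C : eqType) (c : T -> C) g (s : seq T) :
    (forall x, c (g x) = c x) -> uniq (map c s) -> #|porbits g| <= size s ->
  forall x y, c x = c y -> porbit g x = porbit g y.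
Proof.
move=> inv Us le_s x y eqc.
pose c' (X : {set T}) := omap c [pick z in X].
have c'E z : c' (porbit g z) = Some (c z).
  rewrite /c'; case: pickP => [u /= /(invariant_porbit inv)-> // | /(_ z)].
  by rewrite porbit_id.
(* The at most [size s] values over all cycles include [size s] distinct ones, so none is
   repeated. *)
have U2 : uniq (map c' (enum (porbits g))).
  apply: (@leq_size_uniq _ (map (fun z => Some (c z)) s)).
  - by rewrite (map_comp Some c) map_inj_uniq // => ? ? [].
  - move=> _ /mapP[z _ ->]; rewrite -c'E map_f // mem_enum imset_f //.
  by rewrite !size_map -cardE.
have mem z : porbit g z \in enum (porbits g) by rewrite mem_enum imset_f.
by apply: (uniq_map_inj U2); rewrite ?mem // !c'E eqc.
Qed.

Lemma invariant_porbitE (C : eqType) (c : T -> C) g (s : seq T) :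
    (forall x, c (g x) = c x) -> uniq (map c s) -> #|porbits g| <= size s ->
  forall x, porbit g x = [set y | c y == c x].
Proof.
move=> inv Us le_s x; apply/setP => y; rewrite inE.
apply/idP/eqP => [/(invariant_porbit inv)// | eqc].
by rewrite -eq_porbit_mem (invariant_separates inv Us le_s eqc).
Qed.

Lemma invariant_cycle_lengths (C : eqType) (c : T -> C) g (s : seq T) :
    (forall x, c (g x) = c x) -> uniq (map c s) -> #|porbits g| <= size s ->
  perm_eq (cycle_lengths g) [seq #|[set y | c y == c x]| | x <- s].
Proof.
move=> inv Us le_s; have porbE := invariant_porbitE inv Us le_s.
rewrite -(eq_map (fun x => congr1 (fun X : {set T} => #|X|) (porbE x))).
rewrite (map_comp (fun X : {set T} => #|X|)) perm_map // perm_sym.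
have Up : uniq (map (porbit g) s).
  rewrite map_inj_in_uniq; first exact: map_uniq Us.
  move=> x y xs ys exy; apply: (uniq_map_inj Us) => //.
  by apply: (invariant_porbit inv); rewrite -exy porbit_id.
have sub : {subset map (porbit g) s <= enum (porbits g)}.
  by move=> X /mapP[x _ ->]; rewrite mem_enum imset_f.
have [|_ eq_mem] := uniq_min_size Up sub; first by rewrite size_map -cardE.
by apply: uniq_perm; rewrite ?enum_uniq.
Qed.

Definition orbit_count g (A : {set T}) := #|porbit g @: A|.

Lemma card_const_orbits g (A : {set T}) n :
    (forall x, (g x \in A) = (x \in A)) ->
    (forall x, x \in A -> #|porbit g x| = n) ->
  #|A| = orbit_count g A * n.
Proof.
move=> inv const; rewrite -sum1_card.
rewrite (partition_big (porbit g) (mem (porbit g @: A))) /=; last first.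
  by move=> x Ax; apply: imset_f.
rewrite -sum_nat_const; apply: eq_bigr => _ /imsetP[y Ay ->].
rewrite -(const y Ay) sum1_card; apply: eq_card => x.
rewrite [LHS](congr1 (andb _) (eq_porbit_mem g x y)) andbC; case: (boolP (x \in porbit g y)) => //=.
by move/(@invariant_porbit _ (fun z => z \in A) _ inv) => /= ->; rewrite Ay.
Qed.

Lemma orbit_count_gt0 g (A : {set T}) x : x \in A -> 0 < orbit_count g A.
Proof. by move=> Ax; apply/card_gt0P; exists (porbit g x); apply: imset_f. Qed.

Lemma orbit_countT g : orbit_count g setT = #|porbits g|.
Proof. by apply: eq_card => X; apply/imsetP/imsetP => -[x _ ->]; exists x. Qed.

Lemma orbit_countU g (A B : {set T}) :
    (forall x, (g x \in A) = (x \in A)) -> [disjoint A & B] ->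
  orbit_count g (A :|: B) = orbit_count g A + orbit_count g B.
Proof.
move=> inv /pred0P dis; rewrite /orbit_count imsetU cardsU.
rewrite [_ :&: _](_ : _ = set0) ?cards0 ?subn0 //; apply/setP=> X; rewrite !inE.
apply/negP => /andP[/imsetP[x Ax ->] /imsetP[y By /eqP]].
rewrite eq_porbit_mem => /(@invariant_porbit _ (fun z => z \in A) _ inv) /= Ayx.
by have := dis y; rewrite /= -Ayx Ax By.
Qed.

End PermCycles.

Lemma porbit_card_intertwine (T U : finType) (g : {perm T}) (h : {perm U}) (f : T -> U) :
  injective f -> (forall x, f (g x) = h (f x)) ->
  forall x, #|porbit g x| = #|porbit h (f x)|.
Proof.
move=> inj_f fg x; apply: eq_dvdn => n.
have fgn : f ((g ^+ n) x) = (h ^+ n) (f x).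
  by elim: n => [|n IHn]; rewrite ?expg0 ?perm1 // !expgSr !permM fg IHn.
apply/expg_fixP/expg_fixP; rewrite -fgn; first by move->.
exact: inj_f.
Qed.

Lemma cycle_lengths_conj (T U : finType) (g : {perm T}) (h : {perm U}) (f : T -> U) :
  bijective f -> (forall x, f (g x) = h (f x)) ->
  perm_eq (cycle_lengths g) (cycle_lengths h).
Proof.
move=> bij_f fg; apply: perm_cycle_lengths (cycle_lengths_gt0 h) _ => w.
rewrite -cycle_lengths_sum (reindex f) /=; last exact: onW_bij.
by apply: eq_bigr => x _; rewrite (porbit_card_intertwine (bij_inj bij_f) fg).
Qed.

Definition prod_lengths (L1 L2 : seq nat) :=
  flatten [seq nseq (gcdn l1 l2) (lcmn l1 l2) | l1 <- L1, l2 <- L2].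

Lemma size_prod_lengths L1 L2 :
  size (prod_lengths L1 L2) = \sum_(l1 <- L1) \sum_(l2 <- L2) gcdn l1 l2.
Proof.
rewrite size_flatten /shape sumnE big_map big_allpairs_dep /=.
by apply: eq_bigr => l1 _; apply: eq_bigr => l2 _; rewrite size_nseq.
Qed.

Lemma prod_lengths_perm L1 L2 L1' L2' :
  perm_eq L1 L1' -> perm_eq L2 L2' ->
  perm_eq (prod_lengths L1 L2) (prod_lengths L1' L2').
Proof. by move=> p1 p2; apply/perm_flatten/perm_allpairs. Qed.

(** Only the lengths [lcmn] are computed on points; the multiplicity [gcdn l1 l2] results from
    counting, since a pair of cycles has [l1 * l2 = lcmn l1 l2 * gcdn l1 l2] points. *)
Lemma cycle_lengths_prod (T1 T2 T : finType) (g1 : {perm T1}) (g2 : {perm T2})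
    (g : {perm T}) (f : T1 * T2 -> T) L1 L2 :
    bijective f -> (forall x y, g (f (x, y)) = f (g1 x, g2 y)) ->
    perm_eq (cycle_lengths g1) L1 -> perm_eq (cycle_lengths g2) L2 ->
  perm_eq (cycle_lengths g) (prod_lengths L1 L2).
Proof.
move=> bij_f fg p1 p2.
have pos L (T0 : finType) (h : {perm T0}) : perm_eq (cycle_lengths h) L ->
  {in L, forall l, 0 < l}.
  by move=> /perm_mem eqL l; rewrite -eqL; apply/allP/cycle_lengths_gt0.
have lenf x y : #|porbit g (f (x, y))| = lcmn #|porbit g1 x| #|porbit g2 y|.
  apply: eq_dvdn => n; rewrite dvdn_lcm.
  have gn : (g ^+ n) (f (x, y)) = f ((g1 ^+ n) x, (g2 ^+ n) y).
    by elim: n => [|n IHn]; rewrite ?expg0 ?perm1 // !expgSr !permM IHn fg.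
  apply/expg_fixP/andP => [|[/expg_fixP e1 /expg_fixP e2]].
    by rewrite gn => /(bij_inj bij_f)[/expg_fixP-> /expg_fixP->].
  by rewrite gn e1 e2.
apply: perm_cycle_lengths => [|w].
  apply/allP => l /flattenP[_ /allpairsP[[l1 l2] /= [L1l L2l ->]]].
  rewrite mem_nseq => /andP[_ /eqP->].
  by rewrite lcmn_gt0 (pos _ _ _ p1) ?(pos _ _ _ p2).
rewrite (reindex f) /=; last exact: onW_bij.
rewrite (eq_bigr (fun z : T1 * T2 => w (lcmn #|porbit g1 z.1| #|porbit g2 z.2|))).
  rewrite -(pair_bigA _ (fun x y => w (lcmn #|porbit g1 x| #|porbit g2 y|))) /=.
  rewrite (sum_perm_cycle_lengths (fun a => \sum_y w (lcmn a #|porbit g2 y|)) p1).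
  rewrite big_flatten big_allpairs_dep /=; apply: eq_bigr => l1 _.
  rewrite (sum_perm_cycle_lengths (fun b => w (lcmn l1 b)) p2) big_distrr /=.
  apply: eq_bigr => l2 _.
  by rewrite big_nseq iter_addn_0 mulnA -(muln_lcm_gcd l1) mulnAC.
by move=> [x y] _; rewrite lenf.
Qed.

(** * Affine maps and their conjugacy *)

Ltac block_simpl :=
  rewrite ?(mul_row_block, mul_row_col, mul_block_col, mulmx_block, mul_col_mx,
    mul_mx_row, add_row_mx, mulmx0, mul0mx, mulmx1, mul1mx, addr0, add0r).

Section AffineMaps.

Variable p : nat.
Implicit Types (d n m k : nat).

Lemma linM d (a b : 'M['F_p]_d) :
  a \in unitmx -> b \in unitmx -> lin (a *m b)%R = (lin a * lin b)%g.
Proof.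
move=> aU bU; apply/permP => x; rewrite permM !linE ?unitmx_mul ?aU ?bU //.
by rewrite mulmxA.
Qed.

Lemma lin_1 d : lin (1%:M%R : 'M['F_p]_d) = 1%g.
Proof. by apply/permP => x; rewrite linE ?unitmx1 // mulmx1 perm1. Qed.

Lemma translE d (v x : 'rV['F_p]_d) : transl v x = (x + v)%R.
Proof. by rewrite permE. Qed.

Lemma transl0 d : transl (0%R : 'rV['F_p]_d) = 1%g.
Proof. by apply/permP => x; rewrite permE addr0 perm1. Qed.

Lemma expmxSr d (h : 'M['F_p]_d) n : (h ^+ n.+1)%R = (h ^+ n *m h)%R.
Proof. by rewrite exprSr. Qed.

Lemma unitmxX d (h : 'M['F_p]_d) n : h \in unitmx -> (h ^+ n)%R \in unitmx.
Proof.
move=> hU; elim: n => [|n IHn]; first exact: unitmx1.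
by rewrite expmxSr unitmx_mul IHn.
Qed.

Lemma linX d (h : 'M['F_p]_d) n : h \in unitmx -> lin (h ^+ n)%R = (lin h ^+ n)%g.
Proof.
move=> hU; elim: n => [|n IHn]; first exact: lin_1.
by rewrite expmxSr linM ?unitmxX // IHn expgSr.
Qed.

Lemma linXE d (h : 'M['F_p]_d) n (x : 'rV_d) :
  h \in unitmx -> (lin h ^+ n)%g x = (x *m (h ^+ n)%R)%R.
Proof. by move=> hU; rewrite -linX // linE ?unitmxX. Qed.

Lemma lin_inj d : {in unitmx &, injective (@lin p d)}.
Proof.
move=> a b aU bU /permP eq_ab; apply/row_matrixP => i.
by have := eq_ab (delta_mx 0%R i); rewrite !linE // -!rowE.
Qed.

Lemma order_lin_dvdP d (h : 'M['F_p]_d) n : h \in unitmx ->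
  reflect ((h ^+ n)%R = 1%:M%R) (#[lin h] %| n).
Proof.
move=> hU; rewrite order_dvdn -linX // -lin_1.
apply: (iffP eqP) => [|-> //]; apply: lin_inj; rewrite ?unitmx1 //.
exact: unitmxX.
Qed.

Lemma lin_porbit_dvdP d (h : 'M['F_p]_d) (x : 'rV_d) n : h \in unitmx ->
  reflect (x *m (h ^+ n)%R = x)%R (#|porbit (lin h) x| %| n).
Proof. by move=> hU; apply: (iffP (expg_fixP _ _ _)); rewrite linXE. Qed.

Lemma porbit_lin0 d (h : 'M['F_p]_d) : h \in unitmx ->
  #|porbit (lin h) 0%R| = 1.
Proof.
by move=> hU; apply/eqP; rewrite -dvdn1; apply/lin_porbit_dvdP; rewrite ?mul0mx.
Qed.

(** The two dimensions are independent variables and their equality is a conjunct, so that block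
    sums of dimension [k + m] are compared with [h] without casts. *)
Definition lsim n d (h0 : 'M['F_p]_n) (h : 'M['F_p]_d) :=
  exists P : 'M['F_p]_(n, d), [/\ n = d, row_free P & (P *m h = h0 *m P)%R].

(* [x |-> x P + x0] intertwines [t_v0 h0] with [t_v h]. *)
Definition affsim n d (v0 : 'rV['F_p]_n) (h0 : 'M['F_p]_n)
    (v : 'rV['F_p]_d) (h : 'M['F_p]_d) :=
  exists (P : 'M['F_p]_(n, d)) (x0 : 'rV['F_p]_d),
    [/\ n = d, row_free P, (P *m h = h0 *m P)%R
      & ((x0 + v) *m h = x0 + v0 *m h0 *m P)%R].

Lemma lsim_refl d (h : 'M['F_p]_d) : lsim h h.
Proof. by exists 1%:M%R; rewrite row_free_unit unitmx1 mul1mx mulmx1. Qed.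

Lemma affsim_refl d v (h : 'M['F_p]_d) : affsim v h v h.
Proof.
exists 1%:M%R, 0%R; split => //; first by rewrite row_free_unit unitmx1.
  by rewrite mul1mx mulmx1.
by rewrite !add0r mulmx1.
Qed.

Lemma lsim_affsim n d (h0 : 'M['F_p]_n) (h : 'M['F_p]_d) :
  lsim h0 h -> affsim 0%R h0 0%R h.
Proof.
by move=> [P [nd Pf Ph]]; exists P, 0%R; split; rewrite // addr0 !mul0mx addr0.
Qed.

Lemma lsim_trans n m d (h0 : 'M['F_p]_n) (h1 : 'M['F_p]_m) (h2 : 'M['F_p]_d) :
  lsim h0 h1 -> lsim h1 h2 -> lsim h0 h2.
Proof.
move=> [P [nm Pf Ph]] [Q [md Qf Qh]]; exists (P *m Q)%R.
split; [by rewrite nm | | by rewrite -mulmxA Qh mulmxA Ph mulmxA].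
by rewrite /row_free mxrankMfree.
Qed.

Lemma affsim_trans n m d v0 (h0 : 'M['F_p]_n) v1 (h1 : 'M['F_p]_m)
    v2 (h2 : 'M['F_p]_d) :
  affsim v0 h0 v1 h1 -> affsim v1 h1 v2 h2 -> affsim v0 h0 v2 h2.
Proof.
move=> [P [x0 [nm Pf Ph Px]]] [Q [y0 [md Qf Qh Qy]]].
exists (P *m Q)%R, (x0 *m Q + y0)%R.
split; [by rewrite nm | | by rewrite -mulmxA Qh mulmxA Ph mulmxA |].
  by rewrite /row_free mxrankMfree.
rewrite -addrA mulmxDl Qy -mulmxA Qh mulmxA addrCA -mulmxDl -mulmxDl Px.
by rewrite mulmxDl addrCA addrA mulmxA.
Qed.

Lemma affsim_unit n d v0 (h0 : 'M['F_p]_n) v (h : 'M['F_p]_d) :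
  affsim v0 h0 v h -> (h0 \in unitmx) = (h \in unitmx).
Proof.
move=> [P [x0 [nd Pf Ph _]]]; move: P v0 h0 Pf Ph; rewrite {n}nd => P _ h0.
rewrite row_free_unit => PU /(congr1 (fun A => A \in unitmx)).
by rewrite !unitmx_mul PU andbT.
Qed.

Lemma lsim_unit n d (h0 : 'M['F_p]_n) (h : 'M['F_p]_d) :
  lsim h0 h -> (h0 \in unitmx) = (h \in unitmx).
Proof. by move/lsim_affsim/affsim_unit. Qed.

Lemma affsim_bij n d v0 (h0 : 'M['F_p]_n) v (h : 'M['F_p]_d) :
    h \in unitmx -> affsim v0 h0 v h ->
  exists2 f, bijective f &
    forall x, f ((transl v0 * lin h0)%g x) = (transl v * lin h)%g (f x).
Proof.
move=> hU sim; have h0U : h0 \in unitmx by rewrite (affsim_unit sim).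
have [P [x0 [nd Pf Ph Px]]] := sim.
exists (fun x => x *m P + x0)%R => [|x].
  apply: inj_card_bij => [x y /addIr|]; last by rewrite nd.
  exact: row_free_inj.
rewrite !affineE // mulmxDl -addrA [in RHS]mulmxDl Px -mulmxA Ph.
by rewrite !mulmxDl -addrA [(x0 + _)%R]addrC !mulmxA.
Qed.

Lemma affsim_cycles n d v0 (h0 : 'M['F_p]_n) v (h : 'M['F_p]_d) :
    h \in unitmx -> affsim v0 h0 v h ->
  perm_eq (cycle_lengths (transl v * lin h)%g) (cycle_lengths (transl v0 * lin h0)%g).
Proof.
move=> hU /(affsim_bij hU)[f bij_f fP]; rewrite perm_sym.
exact: cycle_lengths_conj fP.
Qed.

Lemma affsim_order n d v0 (h0 : 'M['F_p]_n) v (h : 'M['F_p]_d) :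
    h \in unitmx -> affsim v0 h0 v h ->
  #[transl v * lin h]%g = #[transl v0 * lin h0]%g.
Proof.
move=> hU /(affsim_cycles hU)/order_cycle_lengths->.
by rewrite (order_cycle_lengths (perm_refl _)).
Qed.

Lemma lsim_cycles n d (h0 : 'M['F_p]_n) (h : 'M['F_p]_d) :
    h \in unitmx -> lsim h0 h ->
  perm_eq (cycle_lengths (lin h)) (cycle_lengths (lin h0)).
Proof. by move=> hU /lsim_affsim/(affsim_cycles hU); rewrite !transl0 !mul1g. Qed.

Lemma lsim_order n d (h0 : 'M['F_p]_n) (h : 'M['F_p]_d) :
  h \in unitmx -> lsim h0 h -> #[lin h] = #[lin h0].
Proof. by move=> hU /lsim_affsim/(affsim_order hU); rewrite !transl0 !mul1g. Qed.

Lemma affsim_lsim n d v0 (h0 : 'M['F_p]_n) v (h : 'M['F_p]_d) :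
  affsim v0 h0 v h -> lsim h0 h.
Proof. by move=> [P [x0 [nd Pf Ph _]]]; exists P. Qed.

Lemma affsim_class d v0 (h0 : 'M['F_p]_d) v (h : 'M['F_p]_d) :
    h \in unitmx -> affsim v0 h0 v h ->
  (transl v * lin h)%g \in ((transl v0 * lin h0)%g ^: AGL p d)%g.
Proof.
move=> hU sim; have h0U : h0 \in unitmx by rewrite (affsim_unit sim).
have [P [x0 [_ + Ph Px]]] := sim; rewrite row_free_unit => PU.
(* The intertwining map is x |-> x P + x0 = (x + x0 P^-1) P. *)
apply/imsetP; exists (transl (x0 *m invmx P)%R * lin P)%g.
  by apply/imset2P; exists (x0 *m invmx P)%R P.
apply: (mulgI (transl (x0 *m invmx P)%R * lin P)%g).
rewrite -conjgC; apply/permP => x; rewrite !permM.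
rewrite !translE !linE //.
rewrite [((x + _) *m P)%R]mulmxDl mulmxKV // -addrA mulmxDl -mulmxA Ph Px.
by rewrite mulmxDl mulmxKV // !mulmxDl !mulmxA addrA addrAC.
Qed.

Lemma unitmx_dsum n m (A : 'M['F_p]_n) (B : 'M['F_p]_m) :
  (dsum A B \in unitmx) = (A \in unitmx) && (B \in unitmx).
Proof. by rewrite !unitmxE det_ublock unitrM. Qed.

Lemma affine_dsum_cycles n m (u : 'rV_n) (w : 'rV_m) (A : 'M['F_p]_n)
    (B : 'M['F_p]_m) L1 L2 : A \in unitmx -> B \in unitmx ->
    perm_eq (cycle_lengths (transl u * lin A)%g) L1 ->
    perm_eq (cycle_lengths (transl w * lin B)%g) L2 ->
  perm_eq (cycle_lengths (transl (row_mx u w) * lin (dsum A B))%g)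
          (prod_lengths L1 L2).
Proof.
move=> AU BU; pose f (z : 'rV['F_p]_n * 'rV['F_p]_m) := row_mx z.1 z.2.
apply: (@cycle_lengths_prod _ _ _ _ _ _ f) => [|x y].
  exists (fun z => (lsubmx z, rsubmx z)) => [[x y]|z]; first by rewrite row_mxKl row_mxKr.
  by rewrite /f hsubmxK.
rewrite !affineE ?unitmx_dsum ?AU // add_row_mx /dsum mul_row_block.
by rewrite !mulmx0 addr0 add0r.
Qed.

Lemma lin_dsum_cycles n m (A : 'M['F_p]_n) (B : 'M['F_p]_m) L1 L2 :
    A \in unitmx -> B \in unitmx ->
    perm_eq (cycle_lengths (lin A)) L1 -> perm_eq (cycle_lengths (lin B)) L2 ->
  perm_eq (cycle_lengths (lin (dsum A B))) (prod_lengths L1 L2).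
Proof.
move=> AU BU p1 p2.
have := @affine_dsum_cycles _ _ 0%R 0%R A B L1 L2 AU BU.
by rewrite row_mx0 !transl0 !mul1g; apply.
Qed.

Lemma order_lin_dsum n m (A : 'M['F_p]_n) (B : 'M['F_p]_m) :
    A \in unitmx -> B \in unitmx ->
  #[lin (dsum A B)] = lcmn #[lin A] #[lin B].
Proof.
move=> AU BU; apply: eq_dvdn => k; rewrite dvdn_lcm.
have expd : ((dsum A B) ^+ k)%R = dsum (A ^+ k)%R (B ^+ k)%R.
  elim: k => [|k IHk]; first exact: scalar_mx_block.
  by rewrite !expmxSr IHk mulmx_block !mulmx0 !mul0mx !addr0 add0r.
apply/order_lin_dvdP/andP; rewrite ?unitmx_dsum ?AU // expd.
  rewrite [1%:M%R]scalar_mx_block => /eq_block_mx[eA _ _ eB].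
  by split; apply/order_lin_dvdP.
case=> /(order_lin_dvdP _ AU)-> /(order_lin_dvdP _ BU)->.
by rewrite [RHS]scalar_mx_block.
Qed.

Lemma order_affine_dsum n m (u : 'rV_n) (A : 'M['F_p]_n) (B : 'M['F_p]_m) :
    A \in unitmx -> B \in unitmx ->
  #[transl (row_mx u 0%R) * lin (dsum A B)]%g = lcmn #[transl u * lin A]%g #[lin B].
Proof.
move=> AU BU; have p1 := perm_refl (cycle_lengths (transl u * lin A)%g).
have p2 := perm_refl (cycle_lengths (transl 0%R * lin B)%g).
rewrite (order_cycle_lengths (affine_dsum_cycles AU BU p1 p2)).
have -> : #[lin B] = #[(transl 0%R * lin B)%g] by rewrite transl0 mul1g.
rewrite (order_cycle_lengths p1) (order_cycle_lengths p2).
apply: eq_dvdn => k; rewrite dvdn_lcm !dvdn_biglcm.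
have pos (T : finType) (g : {perm T}) l : l \in cycle_lengths g -> 0 < l.
  by apply/allP/cycle_lengths_gt0.
apply/allP/andP => [dvd | [/allP dvd1 /allP dvd2] l].
  have dvdl l1 l2 : l1 \in cycle_lengths (transl u * lin A)%g ->
      l2 \in cycle_lengths (transl 0%R * lin B)%g -> lcmn l1 l2 %| k.
    move=> L1 L2; apply/dvd/flattenP; exists (nseq (gcdn l1 l2) (lcmn l1 l2)).
      by apply/allpairsP; exists (l1, l2).
    by rewrite mem_nseq gcdn_gt0 (pos _ _ _ L1) eqxx.
  have mem (T : finType) (g : {perm T}) (x : T) : #|porbit g x| \in cycle_lengths g.
    by apply/mapP; exists (porbit g x); rewrite // mem_enum imset_f.
  split; apply/allP => l Ll.
    by have := dvdl _ _ Ll (mem _ _ 0%R); rewrite dvdn_lcm => /andP[].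
  by have := dvdl _ _ (mem _ _ 0%R) Ll; rewrite dvdn_lcm => /andP[].
move=> /flattenP[_ /allpairsP[[l1 l2] /= [L1 L2 ->]]].
rewrite mem_nseq => /andP[_ /eqP->]; rewrite dvdn_lcm.
by apply/andP; split; [apply: dvd1 | apply: dvd2].
Qed.

Lemma affsim_dsum k n d u (A : 'M['F_p]_k) (h0 : 'M['F_p]_n) (h : 'M['F_p]_d) :
  lsim h0 h -> affsim (row_mx u 0%R) (dsum A h0) (row_mx u 0%R) (dsum A h).
Proof.
move=> [P [nd Pf Ph]]; exists (block_mx 1%:M 0 0 P)%R, 0%R; split; first by rewrite nd.
- apply: inj_row_free => x; rewrite -[x]hsubmxK mul_row_block !mulmx0 addr0 add0r.
  rewrite mulmx1 -row_mx0 => /eq_row_mx[-> /eqP].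
  by rewrite mulmx_free_eq0 // => /eqP->; rewrite row_mx0.
- by rewrite /dsum !mulmx_block !mulmx0 !mul0mx !addr0 !add0r mul1mx mulmx1 Ph.
rewrite !add0r /dsum !mul_row_block !mulmx0 !mul0mx !addr0.
by rewrite mul0mx addr0 mulmx1.
Qed.

(** The list brackets sums of three blocks to the left, while splitting off the Jordan block leaves
    [k + (n + m)]. *)
Lemma affsim_dsumA k n m u (A : 'M['F_p]_k) (B : 'M['F_p]_n) (C : 'M['F_p]_m) :
  affsim (row_mx (row_mx u 0) 0)%R (dsum (dsum A B) C)
         (row_mx u 0)%R (dsum A (dsum B C)).
Proof.
pose P : 'M['F_p]_(k + n + m, k + (n + m)) :=
  col_mx (block_mx 1%:M 0 0 (row_mx 1%:M 0))%R (row_mx 0 (row_mx 0 1%:M))%R.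
exists P, 0%R; split; first by rewrite addnA.
- apply: inj_row_free => x; rewrite -[x]hsubmxK -[lsubmx x]hsubmxK /P.
  block_simpl; rewrite -row_mx0 => /eq_row_mx[->].
  by rewrite -row_mx0 => /eq_row_mx[-> ->]; rewrite !row_mx0.
- by rewrite /P /dsum; block_simpl; rewrite !row_mx0 addr0.
by rewrite /P /dsum; block_simpl; rewrite ?row_mx0.
Qed.

Lemma affsim_dsumC k n u (A : 'M['F_p]_k) (B : 'M['F_p]_n) :
  affsim (row_mx 0 u)%R (dsum B A) (row_mx u 0)%R (dsum A B).
Proof.
exists (block_mx 0 1%:M 1%:M 0)%R, 0%R; split; first by rewrite addnC.
- apply: inj_row_free => x; rewrite -[x]hsubmxK; block_simpl.
  by rewrite -row_mx0 => /eq_row_mx[-> ->]; rewrite row_mx0.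
- by rewrite /dsum; block_simpl; rewrite ?row_mx0.
by rewrite /dsum; block_simpl; rewrite ?row_mx0.
Qed.

(** Removes the complement when the Jordan block fills the space and, combined with [affsim_dsumC],
    an empty Jordan block. *)
Lemma affsim_dsum0 k u (A : 'M['F_p]_k) (B : 'M['F_p]_0) :
  affsim u A (row_mx u 0)%R (dsum A B).
Proof.
exists (row_mx 1%:M 0)%R, 0%R; split; first by rewrite addn0.
- apply: inj_row_free => x; block_simpl; rewrite -row_mx0.
  by move=> /eq_row_mx[->].
- by rewrite /dsum; block_simpl; rewrite ?row_mx0.
by rewrite /dsum; block_simpl; rewrite ?row_mx0.
Qed.

Lemma e_row_mx k m : 0 < k -> row_mx (e_ p k 1) (0 : 'rV_m)%R = e_ p (k + m) 1.
Proof.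
move=> k_gt0; apply/rowP => j; rewrite !mxE; case: splitP => i eq_j; rewrite !mxE.
  by rewrite eq_j.
by rewrite eq_j -[_ == _]/(k + i == 0) addn_eq0 gtn_eqF.
Qed.

End AffineMaps.

(** * Splitting off a Jordan block *)

Section JordanSplitting.

Variable p : nat.
Local Open Scope ring_scope.

Definition shiftmx n : 'M['F_p]_n := \matrix_(i, j) (j == i.+1 :> nat)%:R.

Lemma J_shiftmx n : J p n = 1%:M + shiftmx n.
Proof.
apply/matrixP => i j; rewrite !mxE -val_eqE eq_sym /= ![(j : nat) == _]eq_sym.
by case: eqP => [->|_]; rewrite ?add0r //= gtn_eqF ?addr0.
Qed.

Lemma shiftmx_mul n d (A : 'M['F_p]_(n, d)) i j :
  (shiftmx n *m A) i j = \sum_(l < n | l == i.+1 :> nat) A l j.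
Proof.
rewrite mxE [RHS]big_mkcond; apply: eq_bigr => l _; rewrite mxE.
by case: eqP => _; rewrite ?mul1r ?mul0r.
Qed.

Lemma mul_shiftmx n d (A : 'M['F_p]_(d, n)) i j :
  (A *m shiftmx n) i j = \sum_(l < n | l.+1 == j :> nat) A i l.
Proof.
rewrite mxE [RHS]big_mkcond; apply: eq_bigr => l _; rewrite mxE eq_sym.
by case: eqP => _; rewrite ?mulr1 ?mulr0.
Qed.

Lemma sum_ord_eq n (F : 'I_n -> 'F_p) (k : nat) (kn : (k < n)%N) :
  \sum_(l < n | l == k :> nat) F l = F (Ordinal kn).
Proof. by rewrite (big_pred1 (Ordinal kn)). Qed.

Lemma sum_ord_geq n (F : 'I_n -> 'F_p) (k : nat) :
  (n <= k)%N -> \sum_(l < n | l == k :> nat) F l = 0.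
Proof.
move=> le_nk; rewrite big1 // => l /eqP l_k.
by have := ltn_ord l; rewrite l_k ltnNge le_nk.
Qed.

Lemma comm_mulmxX d (h N : 'M['F_p]_d) i :
  h *m N = N *m h -> h *m N ^+ i = N ^+ i *m h.
Proof. by move=> hN; apply: (@commrX _ h N i); apply: hN. Qed.

Lemma expmxD d (N : 'M['F_p]_d) i j : N ^+ (i + j) = N ^+ i *m N ^+ j.
Proof. exact: exprD. Qed.

Lemma expmxS d (N : 'M['F_p]_d) i : N ^+ i.+1 = N *m N ^+ i.
Proof. exact: exprS. Qed.

(** A substitute for the Fitting decomposition: powers repeat in a finite ring, and if
    [N ^+ i = N ^+ j] with [i < j], then v - v N^(j-i) is killed by [N ^+ i]. *)
Lemma shift_into_nilspace d (N : 'M['F_p]_d) (v : 'rV_d) :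
  exists k y, (v + y *m N) *m N ^+ k = 0.
Proof.
have [i [j [lt_ij eN]]] : exists i j : nat, (i < j)%N /\ N ^+ i = N ^+ j.
  have /injectivePn[i [j ne_ij eN]] :
      ~~ injectiveb (fun i : 'I_#|{: 'M['F_p]_d}|.+1 => N ^+ i).
    by apply/injectiveP => /leq_card; rewrite card_ord ltnn.
  have [lt_ij | lt_ji | /val_inj eq_ij] := ltngtP i j.
  - by exists i, j.
  - by exists j, i.
  by rewrite eq_ij eqxx in ne_ij.
exists i, (- v *m N ^+ (j - i).-1); rewrite mulmxDl -!mulmxA -expmxS -expmxD.
have -> : ((j - i).-1 + i.+1 = j)%N by lia.
by rewrite -eN mulNmx addrN.
Qed.

Lemma jordan_chain k d (u : 'rV['F_p]_d) (h N : 'M['F_p]_d) :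
    h = 1%:M + N -> u *m N ^+ k = 0 ->
  (\matrix_(i < k) (u *m N ^+ i)) *m h = J p k *m \matrix_(i < k) (u *m N ^+ i).
Proof.
move=> hE uk0; set C := \matrix_i _.
rewrite hE J_shiftmx mulmxDr mulmxDl mul1mx mulmx1; congr (_ + _).
apply/matrixP => i j; rewrite shiftmx_mul.
have -> : (C *m N) i j = (u *m N ^+ i.+1) 0 j.
  by rewrite expmxSr mulmxA !mxE; apply: eq_bigr => l _; rewrite !mxE.
have [lt | ge] := ltnP i.+1 k; first by rewrite (sum_ord_eq _ lt) !mxE.
by rewrite sum_ord_geq // -(subnKC ge) expmxD mulmxA uk0 mul0mx mxE.
Qed.

(* Choose the origin [y h] of the affine space so that [u N ^+ k = 0] with [k]
   minimal.  Then [u N ^+ (k - 1)] is not in the image of [N ^+ k] (otherwise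
   the origin could be moved to decrease [k]), so some [phi] kills the latter
   but not the former.  The [h]-equivariant map [R], with coordinates
   [x |-> x N ^+ (k - 1 - j) phi], is invertible on the chain
   [u, u N, u N ^+ 2, ...], so its kernel is a complement of it. *)
Lemma jordan_splitting d (v : 'rV['F_p]_d) (h : 'M['F_p]_d) :
  exists k m (h' : 'M['F_p]_m), affsim (row_mx (e_ p k 1) 0) (dsum (J p k) h') v h.
Proof.
pose N := h - 1%:M; have hE : h = 1%:M + N by rewrite addrC subrK.
pose P k := [exists y : 'rV_d, (v + y *m N) *m N ^+ k == 0].
have exP : exists k, P k.
  by have [k [y yk]] := shift_into_nilspace N v; exists k; apply/existsP; exists y; apply/eqP.
case: (ex_minnP exP) => k /existsP[y /eqP uk0] minP {exP}.
set u := v + y *m N in uk0.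
have [phi [phi0 phi1]] : exists phi : 'cV['F_p]_d, N ^+ k *m phi = 0 /\
    ((0 < k)%N -> (u *m N ^+ k.-1 *m phi) 0 0 != 0).
  case: (posnP k) => [-> | k_gt0]; first by exists 0; rewrite mulmx0.
  have : ~~ (u *m N ^+ k.-1 <= N ^+ k)%MS.
    apply/negP => /submxP[z]; rewrite -[in N ^+ k](prednK k_gt0) expmxS => uz.
    suff /minP : P k.-1 by rewrite leqNgt prednK ?leqnn.
    apply/existsP; exists (y - z); apply/eqP; rewrite mulmxBl addrA mulmxBl.
    by rewrite -/u uz mulmxA subrr.
  rewrite submxE => /rV0Pn[j uj]; exists (col j (cokermx (N ^+ k))).
  by rewrite !colE (mulmxA (N ^+ k)) mulmx_coker mul0mx (mulmxA (_ *m _)) -colE mxE.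
pose C : 'M_(k, d) := \matrix_(i < k) (u *m N ^+ i).
pose R : 'M_(d, k) := \matrix_(x < d, j < k) (N ^+ (k.-1 - j) *m phi) x 0.
have CR i j : (C *m R) i j = (u *m N ^+ (i + (k.-1 - j)) *m phi) 0 0.
  rewrite expmxD mulmxA -mulmxA !mxE; apply: eq_bigr => l _; rewrite !mxE.
  by congr (_ * _); rewrite mxE.
have uN i : (k <= i)%N -> u *m N ^+ i = 0.
  by move=> /subnKC<-; rewrite expmxD mulmxA uk0 mul0mx.
have k_gt0 (i : 'I_k) : (0 < k)%N by apply: leq_ltn_trans (ltn_ord i).
(* [C *m R] is upper triangular because [u *m N ^+ k = 0], and its diagonal is constantly u N^(k-1)
   phi, which is nonzero; [det_trig] wants a lower triangular matrix, hence the transpose. *)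
have CRU : C *m R \in unitmx.
  rewrite -unitmx_tr unitmxE det_trig.
    rewrite unitfE; apply/prodf_neq0 => i _; rewrite mxE CR.
    by rewrite subnKC ?phi1 ?(k_gt0 i) // -ltnS prednK ?(k_gt0 i).
  apply/is_trig_mxP => i j lt_ij; rewrite mxE CR uN ?mul0mx ?mxE //.
  by have := ltn_ord j; lia.
have Ch : C *m h = J p k *m C by exact: jordan_chain.
(* Left multiplication by [N] turns column [j] of [R] into column [j - 1], and the first column into
   N^k phi, which is 0 by the choice of [phi]. *)
have hR : h *m R = R *m J p k.
  rewrite hE J_shiftmx mulmxDr mulmxDl mul1mx mulmx1; congr (_ + _).
  apply/matrixP => i j; rewrite mul_shiftmx.
  have -> : (N *m R) i j = (N ^+ (k - j) *m phi) i 0.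
    have -> : (k - j = (k.-1 - j).+1)%N by have := ltn_ord j; lia.
    rewrite expmxS -mulmxA !mxE; apply: eq_bigr => l _; rewrite !mxE.
    by congr (_ * _); rewrite mxE.
  case: j => -[|j] lt_j /=; first by rewrite subn0 phi0 big1 ?mxE.
  rewrite (sum_ord_eq _ (ltnW lt_j)) !mxE /=.
  by have -> : (k - j.+1 = k.-1 - j)%N by lia.
pose K := row_base (kermx R).
have KR : K *m R = 0 by apply/sub_kermxP; rewrite eq_row_base.
have Kh : (K *m h <= K)%MS.
  by rewrite eq_row_base; apply/sub_kermxP; rewrite -mulmxA hR mulmxA KR mul0mx.
(* The new origin is [y *m h]: since y h + v = y + u, it is moved by t_v h to y h + u h. *)
exists k, (\rank (kermx R)), (K *m h *m pinvmx K), (col_mx C K), (y *m h).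
split.
- have rR : \rank R = k.
    apply/eqP; rewrite eqn_leq rank_leq_col /=.
    by rewrite -{1}(mxrank_unit CRU) mxrankM_maxr.
  by rewrite mxrank_ker rR subnKC // -{1}rR rank_leq_row.
- apply: inj_row_free => x; rewrite -[x]hsubmxK mul_row_col => x0.
  have := congr1 (mulmx^~ R) x0.
  rewrite mul0mx mulmxDl -(mulmxA (rsubmx x)) -(mulmxA (lsubmx x)) KR mulmx0 addr0 => x1.
  have xl : lsubmx x = 0 by rewrite -[LHS](mulmxK CRU) x1 mul0mx.
  move/eqP: x0; rewrite xl mul0mx add0r mulmx_free_eq0 ?row_base_free //.
  by move/eqP->; rewrite row_mx0.
- rewrite mul_col_mx Ch /dsum mul_block_col !mul0mx add0r addr0.
  by rewrite mulmxKpV.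
have -> : row_mx (e_ p k 1) 0 *m dsum (J p k) (K *m h *m pinvmx K) *m col_mx C K
  = u *m h.
  rewrite /dsum mul_row_block !mulmx0 !mul0mx !addr0 mul_row_col mul0mx addr0.
  rewrite -mulmxA -Ch mulmxA; congr (_ *m h).
  case: (posnP k) => [k0 | k0].
    have -> : u = 0 by rewrite -uk0 k0 expr0 mulmx1.
    rewrite [e_ _ _ _](_ : _ = 0) ?mul0mx //; apply/rowP => j.
    by have := k_gt0 j; rewrite {1}k0.
  have -> : e_ p k 1 = delta_mx 0 (Ordinal k0).
    by apply/rowP => j; rewrite !mxE eqxx /= -val_eqE.
  by rewrite -rowE rowK expr0 mulmx1.
have -> : y *m h + v = y + u by rewrite /u hE mulmxDr mulmx1 -addrA [X in y + X]addrC.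
by rewrite mulmxDl.
Qed.

End JordanSplitting.

(** * Orders of Jordan blocks and cycle lengths of their translates *)

Section UnipotentBlocks.

Variable p : nat.
Hypothesis p_prime : prime p.
Local Open Scope ring_scope.

Lemma expmx1D_p d (N : 'M['F_p]_d) j :
  (1%:M + N) ^+ (p ^ j) = 1%:M + N ^+ (p ^ j).
Proof.
case: d N => [|d] N; first by apply/matrixP => -[].
elim: j => [|j IHj]; first by rewrite expn0 !expr1.
rewrite expnSr !exprM IHj.
have chM : p \in [pchar 'M['F_p]_d.+1] by rewrite pchar_lalg pchar_Fp.
have := pFrobenius_autD_comm chM (commr_sym (commr1 (N ^+ (p ^ j)))).
by rewrite !pFrobenius_autE expr1n.
Qed.

(* Computed on the homogenization [block_mx 1 (v h) 0 h], which acts on the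
   vectors [(1, x)]: the translation part causes the shift [(p ^ j).-1] in the
   exponent. *)
Lemma affine_expg_p d (v x : 'rV['F_p]_d) (h : 'M['F_p]_d) j : h \in unitmx ->
  ((transl v * lin h) ^+ (p ^ j))%g x =
    x + ((x + v) *m h - x) *m (h - 1%:M) ^+ (p ^ j).-1.
Proof.
move=> hU; pose H := block_mx 1%:M (v *m h) 0 h : 'M['F_p]_(1 + d).
pose N := H - 1%:M.
have iterH n : row_mx 1%:M (((transl v * lin h) ^+ n)%g x) = row_mx 1%:M x *m H ^+ n.
  elim: n => [|n IHn]; first by rewrite expg0 perm1 expr0 mulmx1.
  rewrite expmxSr mulmxA -IHn expgSr permM affineE // /H mul_row_block.
  by rewrite !mulmx1 mulmx0 addr0 mul1mx mulmxDl addrC.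
have NE : N = block_mx 0 (v *m h) 0 (h - 1%:M).
  by rewrite /N /H [X in _ - X]scalar_mx_block opp_block_mx add_block_mx !oppr0 !addr0 addrN.
have stepN y n : row_mx 0 y *m N ^+ n = row_mx 0 (y *m (h - 1%:M) ^+ n).
  elim: n => [|n IHn]; first by rewrite !expr0 !mulmx1.
  by rewrite !expmxSr mulmxA IHn NE mul_row_block !mulmx0 !mul0mx !add0r mulmxA.
have := iterH (p ^ j)%N.
have -> : H = 1%:M + N by rewrite /N addrC subrK.
have pj_gt0 : (0 < p ^ j)%N by rewrite expn_gt0 prime_gt0.
rewrite expmx1D_p mulmxDr mulmx1 -[in N ^+ _](prednK pj_gt0).
rewrite expmxS mulmxA {1}NE mul_row_block !mulmx0 mul1mx add0r mulmxBr mulmx1.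
rewrite addrA -mulmxDl [v + x]addrC stepN add_row_mx addr0.
by case/eq_row_mx.
Qed.

Lemma shiftmxX n i (a b : 'I_n) :
  (shiftmx p n ^+ i) a b = (b == (a + i)%N :> nat)%:R.
Proof.
elim: i a b => [|i IHi] a b; first by rewrite expr0 mxE addn0 eq_sym.
rewrite expmxS shiftmx_mul; have [lt|ge] := ltnP a.+1 n.
  by rewrite (sum_ord_eq _ lt) IHi addSnnS.
by rewrite sum_ord_geq // ltn_eqF // -addSnnS; have := ltn_ord b; lia.
Qed.

Lemma shiftmxX0 n i : (n <= i)%N -> shiftmx p n ^+ i = 0.
Proof.
move=> le_ni; apply/matrixP => a b; rewrite shiftmxX mxE ltn_eqF //.
by have := ltn_ord b; lia.
Qed.

Lemma J_unit n : J p n \in unitmx.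
Proof.
rewrite -unitmx_tr unitmxE det_trig; last first.
  apply/is_trig_mxP => i j lt_ij; rewrite !mxE.
  by case: eqP => [|_]; [lia | case: eqP => //; lia].
rewrite unitfE; apply/prodf_neq0 => i _.
by rewrite !mxE eqxx.
Qed.

(** By Frobenius the power p^j of J_k is 1 + N^(p^j), which is 1 exactly when [k <= p ^ j]. The two
    hypotheses say that [e] is the least such exponent. *)
Lemma order_J k e : (k <= p ^ e)%N -> (0 < e -> p ^ e.-1 < k)%N ->
  #[lin (J p k)] = (p ^ e)%N.
Proof.
move=> le_k lt_k; have ordP j : (#[lin (J p k)] %| p ^ j)%N = (k <= p ^ j)%N.
  apply/order_lin_dvdP/idP; first exact: J_unit.
    rewrite J_shiftmx expmx1D_p -[RHS]addr0 => /addrI eq0.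
    rewrite leqNgt; apply/negP => lt; have k0 : (0 < k)%N by apply: leq_ltn_trans lt.
    have /matrixP/(_ (Ordinal k0) (Ordinal lt)) := eq0.
    by rewrite shiftmxX mxE add0n eqxx => /eqP; rewrite oner_eq0.
  by move=> le; rewrite J_shiftmx expmx1D_p shiftmxX0 // addr0.
have /(dvdn_pfactor _ _ p_prime)[f le_fe ordE] : (#[lin (J p k)] %| p ^ e)%N.
  by rewrite ordP.
rewrite ordE; congr (_ ^ _)%N; apply/eqP; rewrite eqn_leq le_fe leqNgt.
apply/negP => lt_fe; have := lt_k (leq_ltn_trans (leq0n _) lt_fe).
rewrite ltnNge -ordP ordE dvdn_exp2l //.
by rewrite -ltnS prednK // (leq_ltn_trans (leq0n _) lt_fe).
Qed.

(** Whether the power p^j fixes [x] turns out not to depend on [x]: it does so exactly when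
    [k < p ^ j]. The inequality is strict here, unlike in [order_J], because the exponent of the
    nilpotent part is p^j - 1. *)
Lemma transl_J_cycles k e : (0 < k)%N -> (p ^ e.-1 <= k < p ^ e)%N ->
  perm_eq (cycle_lengths (transl (e_ p k 1) * lin (J p k))%g)
          (nseq (p ^ (k - e)) (p ^ e)%N).
Proof.
move=> k_gt0 /andP[le_k lt_k]; have p_gt1 := prime_gt1 p_prime.
have e_gt0 : (0 < e)%N by case: e lt_k {le_k} => //; rewrite expn0; lia.
have le_ek : (e <= k)%N.
  by have := ltn_expl e.-1 p_gt1; lia.
have fixP x j : (#|porbit (transl (e_ p k 1) * lin (J p k))%g x| %| p ^ j)%N
    = (k < p ^ j)%N.
  have fix_eq : (((transl (e_ p k 1) * lin (J p k)) ^+ (p ^ j))%g x == x)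
    = (((x + e_ p k 1) *m J p k - x) *m shiftmx p k ^+ (p ^ j).-1 == 0).
    rewrite affine_expg_p ?J_unit // -subr_eq0 addrAC subrr add0r.
    by rewrite {2}J_shiftmx addrAC subrr add0r.
  have pj_gt0 : (0 < p ^ j)%N by rewrite expn_gt0 prime_gt0.
  apply/expg_fixP/idP => [/eqP | lt]; last first.
    apply/eqP; rewrite fix_eq shiftmxX0 ?mulmx0 //; lia.
  rewrite fix_eq ltnNge; apply: contraTN => le.
  have lt : ((p ^ j).-1 < k)%N by lia.
  apply/eqP => /rowP/(_ (Ordinal lt)) /eqP; apply/negP.
  (* Every [x] is moved by a vector with first coordinate 1; shifting by p^j - 1 carries this 1 to
     the position p^j - 1, which exists unless [k < p ^ j]. *)
  have delta0 : ((x + e_ p k 1) *m J p k - x) 0 (Ordinal k_gt0) = 1.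
    rewrite J_shiftmx mulmxDr mulmx1 -addrA -addrA addrC -!addrA addNr addr0.
    by rewrite mxE mul_shiftmx big1 ?addr0 ?mxE // => i /eqP.
  rewrite mxE (bigD1 (Ordinal k_gt0)) //= big1 => [|i].
    by rewrite addr0 shiftmxX add0n eqxx mulr1 delta0 mxE oner_eq0.
  rewrite -val_eqE /= => i0; rewrite shiftmxX -[X in X == _]add0n eqn_add2r.
  by rewrite eq_sym (negbTE i0) mulr0.
apply: perm_cycle_lengths => [|f].
  by apply/allP => l; rewrite mem_nseq => /andP[_ /eqP->]; rewrite expn_gt0 prime_gt0.
have len x : #|porbit (transl (e_ p k 1) * lin (J p k))%g x| = (p ^ e)%N.
  have /(dvdn_pfactor _ _ p_prime)[f' le_fe lenE] :
    (#|porbit (transl (e_ p k 1) * lin (J p k))%g x| %| p ^ e)%N by rewrite fixP.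
  rewrite lenE; congr (_ ^ _)%N; apply/eqP; rewrite eqn_leq le_fe leqNgt.
  apply/negP => lt_fe; move: le_k; rewrite leqNgt -(fixP x) lenE dvdn_exp2l //.
  by lia.
rewrite (eq_bigr (fun=> f (p ^ e)%N)) => [|x _]; last by rewrite len.
rewrite sum_nat_const card_mx card_Fp // mul1n big_nseq iter_addn_0.
by rewrite -{1}(subnK le_ek) expnD; nia.
Qed.

End UnipotentBlocks.

(** * Linear maps with at most four cycles *)

Section StableSpaces.

Variable p : nat.
Hypothesis p_prime : prime p.
Local Open Scope ring_scope.

Section FixedMatrix.

Variables (d : nat) (h : 'M['F_p]_d).
Hypothesis h_unit : h \in unitmx.
Implicit Types (x y s w : 'rV['F_p]_d) (S T X : 'M['F_p]_d).

Lemma stable_mem m (S : 'M['F_p]_(m, d)) x :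
  stablemx S h -> (lin h x <= S)%MS = (x <= S)%MS.
Proof.
move=> hS; rewrite linE //; apply/idP/idP => [|xS]; last first.
  exact: submx_trans (submxMr h xS) hS.
have /eqmxP Sh : (S *m h == S)%MS.
  by rewrite -(mxrank_leqif_eq hS).2 mxrankMfree ?row_free_unit.
by rewrite -Sh submxMfree // row_free_unit.
Qed.

Lemma card_submx m (S : 'M['F_p]_(m, d)) :
  #|[set x : 'rV['F_p]_d | (x <= S)%MS]| = (p ^ \rank S)%N.
Proof.
transitivity (#|'F_p| ^ \rank S)%N; last by rewrite card_Fp.
by rewrite -card_rowg; apply: eq_card.
Qed.

Lemma comm_exp_sub1 n : comm_mx (h ^+ n - 1%:M) h.
Proof.
rewrite /comm_mx mulmxBl mulmxBr mul1mx mulmx1; congr (_ - _).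
by rewrite -expmxSr -expmxS.
Qed.

Lemma stable_fixker n : stablemx (kermx (h ^+ n - 1%:M)) h.
Proof. exact/comm_mx_stable_ker/comm_exp_sub1. Qed.

(** Turns statements on cycle lengths into inclusions of stable subspaces, to which minimality and
    maximality apply. *)
Lemma sub_fixker x n :
  (x <= kermx (h ^+ n - 1%:M))%MS = (#|porbit (lin h) x| %| n)%N.
Proof.
apply/sub_kermxP/lin_porbit_dvdP => // [|xh].
  by move/eqP; rewrite mulmxBr mulmx1 subr_eq0 => /eqP.
by rewrite mulmxBr mulmx1 xh subrr.
Qed.

Lemma full_fixker n :
  row_full (kermx (h ^+ n - 1%:M)) = (#[lin h] %| n)%N.
Proof.
rewrite -sub1mx; apply/sub_kermxP/order_lin_dvdP => //.
  by move/eqP; rewrite mul1mx subr_eq0 => /eqP.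
by move=> ->; rewrite subrr mulmx0.
Qed.

Lemma exists_mem_diff m1 m2 (T : 'M['F_p]_(m1, d)) (S : 'M['F_p]_(m2, d)) :
  ~~ (T <= S)%MS -> exists2 x : 'rV['F_p]_d, (x <= T)%MS & ~~ (x <= S)%MS.
Proof. by case/row_subPn => i; exists (row i T); rewrite // row_sub. Qed.

(** The vectors of [T] outside [S] span [T]: for [w] among them and [x] in [S], both [x + w] and [w]
    lie outside [S]. *)
Lemma span_diff m1 m2 m3 (S : 'M['F_p]_(m1, d)) (T : 'M['F_p]_(m2, d))
    (X : 'M['F_p]_(m3, d)) : ~~ (T <= S)%MS ->
    (forall x : 'rV['F_p]_d, (x <= T)%MS -> ~~ (x <= S)%MS -> (x <= X)%MS) ->
  (T <= X)%MS.
Proof.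
move=> TS diffX; apply/rV_subP => x xT.
have [xS | /(diffX x xT)//] := boolP (x <= S)%MS.
have [w wT wS] := exists_mem_diff TS.
rewrite -[x](addrK w) addmx_sub ?eqmx_opp ?diffX //; first exact: addmx_sub.
apply: contra wS => xwS; rewrite -[w](addKr x) addmx_sub // eqmx_opp //.
Qed.

Lemma nonzero_mem m (S : 'M['F_p]_(m, d)) : S != 0 -> exists2 x : 'rV['F_p]_d, (x <= S)%MS & x != 0.
Proof. by move/rowV0Pn=> [x xS x0]; exists x. Qed.

Lemma card_porbits_split S : stablemx S h ->
  (#|porbits (lin h)| =
   1 + orbit_count (lin h) [set x : 'rV['F_p]_d | (x <= S)%MS && (x != 0)%R]
     + orbit_count (lin h) [set x : 'rV['F_p]_d | ~~ (x <= S)%MS])%N.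
Proof.
move=> hS; have h0 x : (lin h x == 0) = (x == 0).
  by rewrite linE // mulmx_free_eq0 // row_free_unit.
rewrite -orbit_countT.
rewrite -[setT](_ : [set 0] :|: [set x : 'rV['F_p]_d | (x <= S)%MS && (x != 0)%R]
  :|: [set x : 'rV['F_p]_d | ~~ (x <= S)%MS] = _).
  rewrite !orbit_countU //; first by rewrite /orbit_count imset_set1 cards1.
  - by move=> x; rewrite !inE h0.
  - by rewrite disjoints1 inE eqxx andbF.
  - by move=> x; rewrite !inE h0 stable_mem.
  rewrite disjoints_subset; apply/subsetP=> x; rewrite !inE negbK.
  by case/orP => [/eqP-> | /andP[]//]; rewrite sub0mx.
apply/setP=> x; rewrite !inE; case: (x <= S)%MS; last by rewrite orbT.
by rewrite orbF; case: eqP.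
Qed.

Lemma card_sub_diff S : #|[set x : 'rV['F_p]_d | ~~ (x <= S)%MS]| = (p ^ d - p ^ \rank S)%N.
Proof.
have := cardsC [set x : 'rV['F_p]_d | (x <= S)%MS]; rewrite card_submx card_mx card_Fp // mul1n.
move=> <-; rewrite addKn; apply: eq_card => x.
by rewrite !inE.
Qed.

Lemma card_sub_nonzero S :
  #|[set x : 'rV['F_p]_d | (x <= S)%MS && (x != 0)%R]| = (p ^ \rank S - 1)%N.
Proof.
have := cardsD1 0 [set x : 'rV['F_p]_d | (x <= S)%MS]; rewrite inE sub0mx card_submx => ->.
by rewrite addKn; apply: eq_card => x; rewrite !inE andbC.
Qed.

(* Rows indexed by pairs [(i, j)]: the vectors [b_i psi^j], [j < 2]. *)
Lemma tens_J2_chain a (s : 'M['F_p]_a) (B : 'M['F_p]_(a, d)) (sigma psi : 'M_d) :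
    h = sigma *m (1%:M + psi) -> psi *m sigma = sigma *m psi ->
    psi *m psi = 0 -> B *m sigma = s *m B ->
  exists2 P : 'M['F_p]_(a * 2, d), P *m h = (s *t J p 2) *m P & (B <= P)%MS.
Proof.
move=> hE comm psi2 Bs.
pose P : 'M['F_p]_(a * 2, d) :=
  \matrix_(k, j) (B *m psi ^+ (mxtens_unindex k).2) (mxtens_unindex k).1 j.
have PE i j : row (mxtens_index (i, j)) P = row i (B *m psi ^+ j).
  by apply/rowP => l; rewrite !mxE mxtens_indexK.
exists P; last first.
  apply/row_subP => i; rewrite (_ : row i B = row (mxtens_index (i, ord0)) P) ?row_sub //.
  by rewrite PE expr0 mulmx1.
apply/row_matrixP => k; case: (mxtens_indexP k) => i j.
have commX n : psi ^+ n *m sigma = sigma *m psi ^+ n.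
  by symmetry; apply: comm_mulmxX.
have -> : row (mxtens_index (i, j)) (P *m h) =
    row i (s *m B *m (psi ^+ j + psi ^+ j.+1)).
  rewrite row_mul PE -row_mul hE mulmxA -(mulmxA B) commX mulmxA Bs -mulmxA.
  by rewrite mulmxDr mulmx1 -expmxSr.
rewrite [RHS]row_mul [RHS]mulmx_sum_row (reindex (@mxtens_index a 2)) /=; last first.
  by exists (@mxtens_unindex a 2) => ? _; rewrite ?mxtens_indexK ?mxtens_unindexK.
transitivity (\sum_(i' < a) \sum_(j' < 2) (s i i' * J p 2 j j') *: row i' (B *m psi ^+ j')).
  under eq_bigr => i' _ do under eq_bigr => j' _ do rewrite -scalerA.
  under eq_bigr => i' _ do rewrite -scaler_sumr.
  rewrite -mulmxA row_mul mulmx_sum_row; apply: eq_bigr => i' _.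
  rewrite mxE; congr (_ *: _); rewrite !big_ord_recl big_ord0 addr0 !mxE /=.
  (* The rows of J_2 are (1, 1) and (0, 1); in the second case [psi *m psi = 0] removes the extra
     term. *)
  case: j => -[|[|//]] lt_j /=; rewrite !scale1r ?mulmxDr ?expr0 ?expr1.
    by rewrite linearD.
  by rewrite scale0r add0r expr2 [psi * psi]psi2 mulmx0 addr0.
rewrite pair_bigA; apply: eq_bigr => -[i' j'] _ /=.
rewrite PE; congr (_ *: _); by rewrite -tensmxE [RHS]mxE.
Qed.

End FixedMatrix.

End StableSpaces.

(* The linear members of the list, B2 being the case [a1 = 1] of B1. *)
Inductive lin_class (p : nat) : forall d, 'M['F_p]_d -> seq nat -> Prop :=
| LinSinger d i (s : 'M['F_p]_d) :
    0 < d -> 1 <= i <= 3 -> i %| p ^ d - 1 -> singer s ->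
    lin_class (s ^+ i)%R (1 :: nseq i ((p ^ d - 1) %/ i))
| LinScaledJ2 (s : 'M['F_p]_1) :
    singer s -> lin_class (s *t J p 2)%R [:: 1; p - 1; p * (p - 1)]
| LinSum a1 a2 (s1 : 'M['F_p]_a1) (s2 : 'M['F_p]_a2) :
    p = 2 -> 3 <= a1 + a2 -> gcdn a1 a2 = 1 -> singer s1 -> singer s2 ->
    lin_class (dsum s1 s2)
      [:: 1; 2 ^ a1 - 1; 2 ^ a2 - 1; (2 ^ a1 - 1) * (2 ^ a2 - 1)]
| LinJ3 : p = 2 -> lin_class (J p 3) [:: 1; 1; 2; 4]
| LinSingerJ2 (s : 'M['F_p]_2) :
    p = 2 -> singer s -> lin_class (s *t J p 2)%R [:: 1; 3; 6; 6].

Definition lin_classified p d (h : 'M['F_p]_d) :=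
  exists n (h0 : 'M['F_p]_n) l,
    [/\ lin_class h0 l, lsim h0 h & perm_eq (cycle_lengths (lin h)) l].

(** * Exactly one proper nonzero stable subspace *)

Section UniserialLengthTwo.

Variable p : nat.
Hypothesis p_prime : prime p.
Local Open Scope ring_scope.

Lemma full_mx_max d (h : 'M['F_p]_d) (S : 'M['F_p]_d) :
    (forall X : 'M['F_p]_d, stablemx X h -> ~~ (X <= S)%MS -> row_full X) ->
  forall m (X : 'M['F_p]_(m, d)), stablemx X h -> ~~ (X <= S)%MS -> row_full X.
Proof.
move=> maxS m X hX XS; have := maxS <<X>>%MS.
by rewrite (eqmx_stable _ (genmxE X)) !genmxE /row_full mxrank_gen; apply.
Qed.

(* Multiplication by a generator of the multiplicative group of F_4. *)
Definition fib_mx : 'M['F_p]_(1 + 1) := block_mx 0 1%:M 1%:M 1%:M.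

Hypothesis p2 : p = 2%N.

Lemma add_one_one n : (1%:M + 1%:M : 'M['F_p]_n) = 0.
Proof.
have ch2 : (1 + 1 : 'F_p) = 0 by rewrite p2; apply/val_inj.
by rewrite -raddfD /= ch2 raddf0.
Qed.

Lemma fib_mx_cube : fib_mx *m (fib_mx *m fib_mx) = 1%:M.
Proof.
rewrite /fib_mx; block_simpl.
by rewrite add_one_one addr0 (scalar_mx_block 1 1).
Qed.

Lemma fib_mx_exp3 : fib_mx ^+ 3 = 1%:M.
Proof. by rewrite -fib_mx_cube (expmxS fib_mx 2) (expmxS fib_mx 1). Qed.

Lemma singer_fib : singer fib_mx.
Proof.
have fibU : fib_mx \in unitmx := proj1 (mulmx1_unit fib_mx_cube).
split=> //; have -> : (p ^ (1 + 1) - 1 = 3)%N by rewrite p2.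
apply/(prime_nt_dvdP (isT : prime 3)); last exact/order_lin_dvdP/fib_mx_exp3.
apply/negP => /eqP ord1; have : (#[lin fib_mx] %| 1)%N by rewrite ord1.
move/order_lin_dvdP => /(_ fibU); rewrite expr1 [1%:M](scalar_mx_block 1 1).
by case/eq_block_mx => _ /matrixP/(_ 0 0)/eqP; rewrite !mxE oner_eq0.
Qed.

End UniserialLengthTwo.

(** Rules out equal lengths on both layers. The outer layer is the larger one, so [r1 = 1] and
    [r2 = 2], whence p^d + 2 = 3 p^a; this holds only for p = 2, a = 1, d = 2. *)
Lemma flag_equal_lengths p a d r1 r2 n : prime p -> 0 < a -> a < d ->
    p ^ a - 1 = r1 * n -> p ^ d - p ^ a = r2 * n -> 0 < r1 -> 0 < r2 ->
  r1 + r2 <= 3 -> n = 1.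
Proof.
move=> p_prime a_gt0 lt_ad c1 c2 r10 r20 r12; have p_gt1 := prime_gt1 p_prime.
have q_ge : p <= p ^ a by rewrite -{1}[p]expn1 leq_exp2l.
have Q_ge : p * p ^ a <= p ^ d by rewrite -expnS leq_exp2l.
have [r1E r2E] : r1 = 1 /\ r2 = 2 by nia.
have p2 : p = 2 by nia.
move: lt_ad; rewrite leq_eqVlt => /predU1P[e | lt].
  by move: c1 c2; rewrite -e expnS p2 r1E r2E; lia.
have : p ^ a.+2 <= p ^ d by rewrite leq_exp2l.
by rewrite !expnS; nia.
Qed.

Lemma flag_lengths p a r1 r2 n : prime p -> 0 < a ->
    p ^ a - 1 = r1 * n -> p ^ (a + a) - p ^ a = r2 * (n * p) -> 0 < n ->
    0 < r1 -> 0 < r2 -> r1 + r2 <= 3 ->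
  [/\ a = 1, n = p - 1, r1 = 1 & r2 = 1] \/
  [/\ p = 2, a = 2, n = 3, r1 = 1 & r2 = 2].
Proof.
move=> p_prime a_gt0 c1 c2 n0 r10 r20 r12; have p_gt1 := prime_gt1 p_prime.
have q_ge : p <= p ^ a by rewrite -{1}[p]expn1 leq_exp2l.
(* The quotient of the two counts: the second is p^a times the first. *)
have rel : r2 * p = p ^ a * r1.
  apply/eqP; rewrite -(eqn_pmul2l n0) mulnCA -c2 expnD -{3}[p ^ a]muln1 -mulnBr.
  by rewrite c1 mulnCA mulnC mulnA [n * _]mulnC.
have [[r1E r2E] | [r1E r2E]] : (r1 = 1 /\ r2 = 1) \/ (r1 = 1 /\ r2 = 2) by nia.
  left; have aE : a = 1.
    by apply/eqP; rewrite -(eqn_exp2l _ _ p_gt1) expn1; apply/eqP; nia.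
  by split=> //; rewrite aE expn1 r1E mul1n in c1.
right; have [p2 aE] : p = 2 /\ a = 2.
  case: a a_gt0 rel {c1 c2 q_ge} => // a _; rewrite expnS r1E r2E muln1 mulnC.
  move/eqP; rewrite eqn_pmul2l ?(ltnW p_gt1) // => /eqP pa.
  have p2 : p = 2.
    apply/eqP; rewrite -dvdn_prime2 // pa.
    by case: a pa => // a _; rewrite expnS dvdn_mulr.
  split=> //; congr _.+1.
  by apply/eqP; rewrite -(eqn_exp2l _ _ p_gt1) -pa expn1 p2.
by split=> //; rewrite aE p2 r1E mul1n in c1.
Qed.

Section UniserialTwo.

Variable p : nat.
Hypothesis p_prime : prime p.
Local Open Scope ring_scope.

Variables (d : nat) (h S : 'M['F_p]_d).
Hypotheses (h_unit : h \in unitmx) (hS : stablemx S h).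

Lemma cycle_lengths_flag r1 r2 n L :
    (forall x : 'rV['F_p]_d, (x <= S)%MS -> x != 0 -> #|porbit (lin h) x| = n) ->
    (forall x : 'rV['F_p]_d, ~~ (x <= S)%MS -> #|porbit (lin h) x| = L) ->
    (0 < n)%N -> (0 < L)%N ->
    (p ^ \rank S - 1 = r1 * n)%N -> (p ^ d - p ^ \rank S = r2 * L)%N ->
  perm_eq (cycle_lengths (lin h)) (1%N :: nseq r1 n ++ nseq r2 L).
Proof.
move=> lenS lenV n0 L0 c1 c2; apply: perm_cycle_lengths => [|f].
  by rewrite /= all_cat !all_nseq n0 L0 !orbT.
rewrite (bigID (fun x => x <= S)%MS) /= (bigD1 0) ?sub0mx //= porbit_lin0 //.
rewrite (eq_bigr (fun=> f n)) => [|x /andP[]]; last by move=> *; rewrite lenS.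
rewrite [X in (_ + X)%N](eq_bigr (fun=> f L)) => [|x xS]; last by rewrite lenV.
rewrite !sum_nat_const big_cons big_cat !big_nseq !iter_addn_0 mul1n -addnA.
have := card_sub_nonzero p_prime S; have := card_sub_diff p_prime S.
rewrite c1 c2 !cardsE => -> ->; congr (_ + (_ + _))%N; lia.
Qed.

Hypothesis few : (#|porbits (lin h)| <= 4)%N.
Hypotheses (S_gt0 : (0 < \rank S)%N) (S_lt : (\rank S < d)%N).
Hypothesis minS :
  forall X : 'M['F_p]_d, stablemx X h -> X != 0 -> (S <= X)%MS.
Hypothesis maxS :
  forall X : 'M['F_p]_d, stablemx X h -> ~~ (X <= S)%MS -> row_full X.

(** A stable line contains the least stable subspace [S], hence equals it. *)
Lemma no_eigenvector_outside (t : 'rV['F_p]_d) c :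
  t *m h = c *: t -> (t <= S)%MS.
Proof.
move=> th; have [->|t0] := eqVneq t 0; first exact: sub0mx.
have tS : (S <= <<t>>)%MS.
  apply: minS; last by rewrite -mxrank_eq0 mxrank_gen mxrank_eq0.
  by rewrite (eqmx_stable _ (genmxE t)) th scalemx_sub.
have : \rank S == \rank <<t>>%MS.
  rewrite eqn_leq mxrankS //= mxrank_gen rank_rV t0; exact: S_gt0.
by rewrite (mxrank_leqif_eq tS) => /eqmxP e; rewrite e genmxE.
Qed.

(** By [minS], a kernel of h^m - 1 that contains one nonzero vector of [S] contains [S]; by [maxS],
    one that contains a vector outside [S] is everything. So each layer has a single length, and the
    outer one is the order of [h]. *)
Lemma uniserial_two_lengths : exists r1 r2 n L : nat,
  [/\ [/\ (forall x : 'rV['F_p]_d, (x <= S)%MS -> x != 0 -> #|porbit (lin h) x| = n),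
      (forall x : 'rV['F_p]_d, ~~ (x <= S)%MS -> #|porbit (lin h) x| = L)
      & #[lin h] = L], (0 < n)%N /\ (0 < L)%N,
    (p ^ \rank S - 1 = r1 * n)%N, (p ^ d - p ^ \rank S = r2 * L)%N
    & [/\ (0 < r1)%N, (0 < r2)%N & (r1 + r2 <= 3)%N]].
Proof.
have Snz : S != 0 by rewrite -mxrank_eq0 -lt0n.
have [s sS s0] := nonzero_mem Snz.
have dvdS (x : 'rV['F_p]_d) m : (x <= S)%MS -> x != 0 ->
    (#|porbit (lin h) x| %| m)%N = (S <= kermx (h ^+ m - 1%:M))%MS.
  move=> xS x0; rewrite -sub_fixker //; apply/idP/idP => [xk | ]; last first.
    exact: submx_trans.
  apply: minS; first exact: stable_fixker.
  by apply: contraNneq x0 => k0; rewrite k0 submx0 in xk.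
have lenS x : (x <= S)%MS -> x != 0 -> #|porbit (lin h) x| = #|porbit (lin h) s|.
  by move=> xS x0; apply: eq_dvdn => m; rewrite !dvdS.
have lenV x : ~~ (x <= S)%MS -> #|porbit (lin h) x| = #[lin h].
  move=> xS; apply: eq_dvdn => m; rewrite -sub_fixker // -full_fixker //.
  apply/idP/idP => [xk | ]; last exact: submx_full.
  apply: maxS; first exact: stable_fixker.
  by apply: contra xS; apply: submx_trans.
have [w _ wS] : exists2 w : 'rV['F_p]_d, (w <= (1%:M : 'M['F_p]_d))%MS & ~~ (w <= S)%MS.
  by apply: exists_mem_diff; rewrite sub1mx /row_full ltn_eqF.
have := card_porbits_split h_unit hS.
set A1 := [set x | _]; set A2 := [set x | _] => split.
exists (orbit_count (lin h) A1), (orbit_count (lin h) A2).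
exists #|porbit (lin h) s|, #[lin h]; split.
- by split.
- by rewrite card_porbit_gt0 order_gt0.
- rewrite -card_sub_nonzero //; apply: card_const_orbits => x; rewrite !inE.
    by rewrite stable_mem // linE // mulmx_free_eq0 // row_free_unit.
  by case/andP; apply: lenS.
- rewrite -card_sub_diff //; apply: card_const_orbits => x; rewrite !inE.
    by rewrite stable_mem.
  exact: lenV.
split; last by move: few; rewrite split -addnA.
  by apply: (@orbit_count_gt0 _ _ _ s); rewrite inE sS.
by apply: (@orbit_count_gt0 _ _ _ w); rewrite inE.
Qed.

(* With [n] the order of [h] on [S], [phi = h ^+ n - 1] has kernel and image
   [S], whence [#[lin h] = n p]: comparing with the number [p ^ d - p ^ \rank S]
   of vectors outside [S] leaves only two possibilities. *)
Lemma uniserial_two_order :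
  exists n : nat,
   [/\ d = (\rank S + \rank S)%N,
     forall x : 'rV['F_p]_d, (x <= S)%MS -> x != 0 -> #|porbit (lin h) x| = n,
     (h ^+ n - 1%:M) *m (h ^+ n - 1%:M) = 0, #[lin h] = (n * p)%N
   & [/\ \rank S = 1, n = p - 1 &
        perm_eq (cycle_lengths (lin h)) [:: 1; p - 1; p * (p - 1)]]%N \/
     [/\ p = 2, \rank S = 2, n = 3 &
        perm_eq (cycle_lengths (lin h)) [:: 1; 3; 6; 6]]%N].
Proof.
have [r1 [r2 [n [L [[lenS lenV ordh] [n0 L0] c1 c2 [r10 r20 r12]]]]]] :=
  uniserial_two_lengths.
have cyc := cycle_lengths_flag lenS lenV n0 L0 c1 c2.
have p_gt1 := prime_gt1 p_prime.
have Snz : S != 0 by rewrite -mxrank_eq0 -lt0n.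
have [s sS s0] := nonzero_mem Snz.
have [w _ wS] : exists2 w : 'rV['F_p]_d, (w <= (1%:M : 'M['F_p]_d))%MS & ~~ (w <= S)%MS.
  by apply: exists_mem_diff; rewrite sub1mx /row_full ltn_eqF.
have Sker m : (S <= kermx (h ^+ m - 1%:M))%MS = (n %| m)%N.
  apply/idP/idP => [Sk | nm].
    by rewrite -(lenS s) // -sub_fixker // (submx_trans sS).
  apply/rV_subP => x xS; have [->|x0] := eqVneq x 0; first exact: sub0mx.
  by rewrite sub_fixker // lenS.
have nL : (n %| L)%N by rewrite -Sker submx_full // full_fixker // ordh.
(* If the lengths agree, counting makes them 1, and [w] is a fixed vector outside [S]. *)
have [Ln | Ln] := boolP (L %| n)%N.
  have {nL Ln}eL : L = n by apply/eqP; rewrite eqn_dvd Ln.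
  suff n1 : n = 1%N.
    have hw : w *m h = 1 *: w.
      have : (#|porbit (lin h) w| %| 1)%N by rewrite lenV // eL n1.
      by move/lin_porbit_dvdP => /(_ h_unit); rewrite expr1 scale1r.
    by rewrite (no_eigenvector_outside hw) in wS.
  by rewrite eL in c2; apply: flag_equal_lengths c1 c2 _ _ _.
set phi := h ^+ n - 1%:M.
have hphi : comm_mx phi h by apply: comm_exp_sub1.
have phi0 : phi != 0.
  apply: contraNneq Ln => phi0.
  by rewrite -ordh -full_fixker // -/phi phi0 -sub1mx; apply/sub_kermxP; rewrite mulmx0.
have Sphi : (S <= kermx phi)%MS by rewrite Sker.
have kerS : (kermx phi <= S)%MS.
  apply: contraR Ln => kS; rewrite -ordh -full_fixker //.
  by apply: maxS => //; apply: stable_fixker.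
have Sim : (S <= phi)%MS by apply: minS => //; apply: comm_mx_stable.
have rker := mxrank_ker phi.
have eker : \rank (kermx phi) = \rank S by apply/eqP; rewrite eqn_leq !mxrankS.
have imS : (phi <= S)%MS.
  apply/negPn/negP => pS; have := maxS (comm_mx_stable hphi) pS.
  by rewrite /row_full => /eqP full; move: S_gt0; rewrite -eker rker full subnn.
have eim : \rank phi = \rank S by apply/eqP; rewrite eqn_leq !mxrankS.
have dS : (d - \rank S = \rank S)%N by rewrite -{1}eim -rker.
have dE : d = (\rank S + \rank S)%N by rewrite -[LHS](subnK (ltnW S_lt)) dS.
have phi2 : phi *m phi = 0.
  by apply/eqP; rewrite -submx0; apply: submx_trans (submxMr phi imS) _; rewrite (sub_kermxP Sphi).
(* Since phi^2 = 0 and p >= 2, (1 + phi)^p = 1 + phi^p = 1. Hence L / n divides [p], and it is not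
   1. *)
have Lnp : (L %| n * p)%N.
  rewrite -ordh; apply/order_lin_dvdP => //; rewrite exprM.
  have -> : h ^+ n = 1%:M + phi by rewrite addrC subrK.
  rewrite -[p in _ ^+ p]expn1 expmx1D_p // expn1.
  have phiX m : (1 < m)%N -> phi ^+ m = 0.
    by case: m => [|[|m]] // _; rewrite !expmxS mulmxA phi2 mul0mx.
  by rewrite phiX // addr0.
have {Lnp}eL : L = (n * p)%N.
  case/dvdnP: nL => t Lt; rewrite Lt mulnC dvdn_pmul2l // in Lnp *.
  congr (_ * _)%N; apply/prime_nt_dvdP => //.
  by apply: contraNneq Ln => t1; rewrite Lt t1 mul1n.
exists n; split; rewrite // ?ordh //.
have c2' : (p ^ (\rank S + \rank S) - p ^ \rank S = r2 * (n * p))%N.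
  by rewrite -dE -eL.
have [[aE nE r1E r2E] | [p2 aE nE r1E r2E]] :=
    flag_lengths p_prime S_gt0 c1 c2' n0 r10 r20 r12.
  by left; split=> //; move: cyc; rewrite r1E r2E eL nE mulnC.
right; split=> //; move: cyc; rewrite r1E r2E eL nE.
by have -> : (3 * p = 6)%N by rewrite p2.
Qed.

Lemma uniserial_two_classified : lin_classified h.
Proof.
have [n [dE lenS phi2 ordh alt]] := uniserial_two_order.
have Snz : S != 0 by rewrite -mxrank_eq0 -lt0n.
have [s sS s0] := nonzero_mem Snz.
have [w _ wS] : exists2 w : 'rV['F_p]_d, (w <= (1%:M : 'M['F_p]_d))%MS & ~~ (w <= S)%MS.
  by apply: exists_mem_diff; rewrite sub1mx /row_full ltn_eqF.
(* The rows produced by [tens_J2_chain] span a stable subspace that contains [w], hence the whole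
   space by [maxS]. *)
have tens_lsim a (t : 'M['F_p]_a) (B : 'M['F_p]_(a, d)) (sigma psi : 'M['F_p]_d) :
    (a * 2)%N = d -> (w <= B)%MS ->
    h = sigma *m (1%:M + psi) -> psi *m sigma = sigma *m psi ->
    psi *m psi = 0 -> B *m sigma = t *m B -> lsim (t *t J p 2) h.
  move=> ad wB hE comm psi0 Bt; have [P Ph BP] := tens_J2_chain hE comm psi0 Bt.
  exists P; split=> //.
  suff /eqP e : row_full P by rewrite /row_free e ad.
  apply: (full_mx_max maxS); first by rewrite Ph submxMl.
  by apply: contra wS; apply: submx_trans; apply: submx_trans BP.
case: alt => [[rS nE cyc] | [p2 rS nE cyc]].
  have lineS : (S <= s)%MS.
    have sleS : \rank s == \rank S by rewrite rank_rV s0 rS.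
    by move: sleS; rewrite (mxrank_leqif_eq sS) => /andP[].
  have [c sh] : exists c, s *m h = c *: s.
    by apply/sub_rVP; apply: submx_trans lineS; apply: submx_trans (submxMr h sS) hS.
  have c0 : c != 0.
    apply: contraNneq s0 => c0; move: sh; rewrite c0 scale0r => /eqP.
    by rewrite mulmx_free_eq0 // row_free_unit.
  have shX m : s *m h ^+ m = c ^+ m *: s.
    elim: m => [|m IHm]; first by rewrite mulmx1 scale1r.
    by rewrite expmxSr mulmxA IHm -scalemxAl sh scalerA exprSr.
  pose phi := h - c%:M; have hE : h = c%:M + phi by rewrite addrC subrK.
  have phi_comm : comm_mx phi h.
    by rewrite /comm_mx mulmxBl mulmxBr scalar_mxC.
  have phi0 : phi != 0.
    apply: contraNneq wS => phi0.
    by apply: (@no_eigenvector_outside _ c); rewrite hE phi0 addr0 mul_mx_scalar.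
  have sphi : s *m phi = 0 by rewrite mulmxBr sh mul_mx_scalar subrr.
  have Sphi : S *m phi = 0.
    by apply/eqP; rewrite -submx0; apply: submx_trans (submxMr phi lineS) _; rewrite sphi sub0mx.
  (* Otherwise the stable image of [phi] would be everything, although [phi] kills [s]. With S phi =
     0 this gives phi^2 = 0. *)
  have imS : (phi <= S)%MS.
    apply/negPn/negP => pS; have := maxS (comm_mx_stable phi_comm) pS.
    rewrite row_full_unit => phiU; case/eqP: s0.
    by rewrite -[s](mulmxK phiU) sphi mul0mx.
  have phi2' : phi *m phi = 0.
    by apply/eqP; rewrite -submx0; apply: submx_trans (submxMr phi imS) _; rewrite Sphi.
  have tE m : (c%:M : 'M['F_p]_1) ^+ m = (c ^+ m)%:M.
    elim: m => [|m IHm]; first by rewrite !expr0.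
    by rewrite expmxSr IHm -scalar_mxM exprSr.
  have tU : (c%:M : 'M['F_p]_1) \in unitmx by rewrite unitmxE det_scalar expr1 unitfE.
  exists _, ((c%:M : 'M_1) *t J p 2), [:: 1; p - 1; p * (p - 1)]%N; split=> //.
    (* The order of the eigenvalue [c] is the cycle length [n = p - 1] of its eigenvector [s], so
       [c] generates the multiplicative group. *)
    apply: LinScaledJ2; split=> //; rewrite expn1 -nE -(lenS s) //.
    apply: eq_dvdn => m; apply/order_lin_dvdP/lin_porbit_dvdP => //; rewrite tE shX.
      by move/matrixP/(_ 0 0); rewrite !mxE eqxx !mulr1n => ->; rewrite scale1r.
    move/eqP; rewrite -subr_eq0 -[X in _ - X]scale1r -scalerBl scaler_eq0 (negbTE s0).
    by rewrite orbF subr_eq0 => /eqP->.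
  apply: (tens_lsim 1%N _ w c%:M (c^-1 *: phi)) => //.
  - by rewrite mul1n dE rS.
  - by rewrite mulmxDr mulmx1 mul_scalar_mx scalerA divff // scale1r.
  - by rewrite scalar_mxC.
  - by rewrite -scalemxAl -scalemxAr phi2' !scaler0.
  by rewrite scalar_mxC.
have char2 m : (1%:M + 1%:M : 'M['F_p]_m) = 0 by apply: add_one_one.
(* [h] has order 6: [h ^+ 4] is its part of order 3, [h ^+ 3 = 1 + phi] its part of order 2, and
   their product is h^7 = h. *)
have [sigma sigma_def] : exists sg, sg = h ^+ 4 by exists (h ^+ 4).
pose phi := h ^+ 3 - 1%:M.
have h3 : h ^+ 3 = 1%:M + phi by rewrite addrC subrK.
have phi0 : phi *m phi = 0 by rewrite nE in phi2.
(* sigma^3 = 1 and sigma - 1 is injective: a nonzero kernel would contain [S], where the cycle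
   length 3 does not divide 4. So the cofactor 1 + sigma + sigma^2 of sigma^3 - 1 vanishes. *)
have sigmaE : 1%:M + sigma + sigma *m sigma = 0.
  have free : row_free (sigma - 1%:M).
    rewrite sigma_def.
    rewrite -kermx_eq0; apply: contraT => k0.
    have := minS (stable_fixker h 4) k0 => Sk.
    have := submx_trans sS Sk; rewrite sub_fixker // lenS // nE.
    by [].
  apply/eqP; rewrite -(mulmx_free_eq0 _ free) mulmxBr mulmx1 !mulmxDl mul1mx.
  have -> : sigma *m sigma *m sigma = 1%:M.
    have h6 : h ^+ 6 = 1%:M by apply/order_lin_dvdP; rewrite // ordh nE p2.
    transitivity (sigma ^+ 3); first by rewrite !expmxSr expr0 mul1mx.
    by rewrite sigma_def -exprM -[(4 * 3)%N]/(6 * 2)%N exprM h6 expmxSr mulmx1.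
  by rewrite [sigma + _ + _]addrC addrA subrr.
exists _, (fib_mx p *t J p 2), [:: 1; 3; 6; 6]%N; split=> //.
  by apply: LinSingerJ2 => //; apply: singer_fib.
apply: (@tens_lsim 2 _ (col_mx w (w *m sigma)) sigma (- phi)) => //.
- by rewrite dE rS.
- by rewrite -addsmxE addsmxSl.
- have -> : sigma = h *m (1%:M + phi) by rewrite -h3 -expmxS.
  have e : (1%:M + phi) *m (1%:M - phi) = 1%:M.
    by rewrite mulmxDl mul1mx mulmxBr mulmx1 phi0 subr0 subrK.
  by rewrite -mulmxA e mulmx1.
- by rewrite mulNmx mulmxN /phi mulmxBl mulmxBr mul1mx mulmx1 sigma_def -!expmxD addnC.
- by rewrite mulNmx mulmxN phi0 !oppr0.
(* On [w] and [w sigma], [sigma] acts by [fib_mx], because w sigma^2 = w + w sigma in characteristic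
   2. *)
rewrite mul_col_mx /fib_mx mul_block_col !mul0mx !mul1mx add0r; congr col_mx.
apply/eqP; rewrite -subr_eq0 opprD addrC.
have neg m (x : 'rV['F_p]_m) : - x = x.
  by apply/eqP; rewrite eq_sym -addr_eq0 -[x]mulmx1 -mulmxDr char2 mulmx0.
by rewrite !neg -{1}[w]mulmx1 -mulmxA -!mulmxDr sigmaE mulmx0.
Qed.

End UniserialTwo.

(** Arithmetic of the three-layer case. For odd [p] the left side is too large to divide. For p = 2
    the factor 2^t of the left side is coprime to 2^a - 1, so it divides 4, which gives t = 2 and a
    = 1; then 2^d - 4 divides 4. *)
Lemma chain_dimensions p a t d : prime p -> 0 < a -> a < t -> t < d ->
  (p ^ d - p ^ t) %| (if p == 2 then 4 else p) * (p ^ a - 1) ->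
  [/\ p = 2, a = 1, t = 2 & d = 3].
Proof.
move=> p_prime a_gt0 lt_at lt_td; have p_gt1 := prime_gt1 p_prime.
have q_ge : p <= p ^ a by rewrite -{1}[p]expn1 leq_exp2l.
have t_ge : p * p ^ a <= p ^ t by rewrite -expnS leq_exp2l.
have d_ge : p * p ^ t <= p ^ d by rewrite -expnS leq_exp2l.
case: eqVneq => [p2 | np2] dvd; last first.
  have := dvdn_leq _ dvd; have : 0 < p by lia.
  by move: dvd => _; nia.
have dvd4 : 2 ^ t %| 2 ^ 2.
  have /Gauss_dvdl <- : coprime (2 ^ t) (2 ^ a - 1).
    rewrite coprimeXl // coprime2n oddB ?expn_gt0 // oddX /=.
    by case: a a_gt0 {lt_at q_ge t_ge dvd}.
  apply: dvdn_trans; last by rewrite p2 in dvd; exact: dvd.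
  by rewrite dvdn_sub ?dvdn_exp2l // ltnW.
rewrite dvdn_Pexp2l // in dvd4.
have tE : t = 2 by lia.
have aE : a = 1 by lia.
split=> //; move: dvd; rewrite p2 tE aE muln1 => /dvdn_leq -/(_ isT).
have [d4|] := leqP 4 d; last by lia.
by have : 2 ^ 4 <= 2 ^ d by [rewrite leq_exp2l]; lia.
Qed.

(** * Two nested proper nonzero stable subspaces *)

Section UniserialThree.

Variable p : nat.
Hypothesis p_prime : prime p.
Local Open Scope ring_scope.

Variables (d : nat) (h S T : 'M['F_p]_d).
Hypotheses (h_unit : h \in unitmx) (hS : stablemx S h) (hT : stablemx T h).
Hypothesis few : (#|porbits (lin h)| <= 4)%N.
Hypotheses (S_gt0 : (0 < \rank S)%N) (ST : (S <= T)%MS).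
Hypotheses (ST_lt : (\rank S < \rank T)%N) (T_lt : (\rank T < d)%N).

Lemma uniserial_three_classified : lin_classified h.
Proof.
have TS : ~~ (T <= S)%MS by apply: contraL ST_lt => /mxrankS; rewrite -leqNgt.
have VT : ~~ (1%:M <= T)%MS.
  by apply: contraL T_lt => /mxrankS; rewrite mxrank1 -leqNgt.
have [s sS s0] : exists2 s : 'rV['F_p]_d, (s <= S)%MS & s != 0.
  by apply: nonzero_mem; rewrite -mxrank_eq0 -lt0n.
have [t tT tS] := exists_mem_diff TS; have [w _ wT] := exists_mem_diff VT.
have wS : ~~ (w <= S)%MS by apply: contra wT => wS; apply: submx_trans ST.
have t0 : t != 0 by apply: contraNneq tS => ->; apply: sub0mx.
have w0 : w != 0 by apply: contraNneq wS => ->; apply: sub0mx.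
(* This invariant takes four values, so the four cycles are 0 and the layers of [S], [T] and the
   whole space. A stable subspace containing one vector of a layer contains the layer, hence its
   span. *)
pose c (x : 'rV['F_p]_d) := (x == 0, (x <= S)%MS, (x <= T)%MS).
have inv x : c (lin h x) = c x.
  by rewrite /c !stable_mem // linE // mulmx_free_eq0 // row_free_unit.
have Uc : uniq (map c [:: 0; s; t; w]).
  rewrite /c /= !inE !eqxx !sub0mx sS (submx_trans sS ST) tT.
  by rewrite (negbTE s0) (negbTE t0) (negbTE w0) (negbTE tS) (negbTE wT) (negbTE wS).
have porbE := invariant_porbitE inv Uc few.
have cyc := invariant_cycle_lengths inv Uc few.
have orb_in m (X : 'M['F_p]_(m, d)) x y :
    stablemx X h -> (x <= X)%MS -> c x = c y -> (y <= X)%MS.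
  move=> hX xX cxy; have : y \in porbit (lin h) x by rewrite porbE inE cxy.
  by move/(@invariant_porbit _ _ (fun z => z <= X)%MS _ (fun z => stable_mem h_unit z hX))->.
have spanT m (X : 'M['F_p]_(m, d)) (x : 'rV['F_p]_d) :
    stablemx X h -> (x <= T)%MS -> ~~ (x <= S)%MS -> (x <= X)%MS -> (T <= X)%MS.
  move=> hX xT xS xX; apply: (span_diff TS) => y yT yS; apply: (orb_in _ _ _ _ hX xX).
  have nz z : ~~ (z <= S)%MS -> (z == 0) = false.
    by move=> zS; apply/negP => /eqP z0; rewrite z0 sub0mx in zS.
  by rewrite /c xT yT (negbTE xS) (negbTE yS) !nz.
have spanV m (X : 'M['F_p]_(m, d)) (x : 'rV['F_p]_d) :
    stablemx X h -> ~~ (x <= T)%MS -> (x <= X)%MS -> row_full X.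
  move=> hX xT xX; rewrite -sub1mx.
  apply: (span_diff VT) => y _ yT; apply: (orb_in _ _ _ _ hX xX).
  have nT z : ~~ (z <= T)%MS -> c z = (false, false, false).
    move=> zT; rewrite /c (negbTE zT); congr (_, _, _).
      by apply/negP => /eqP z0; rewrite z0 sub0mx in zT.
    by apply/negP => zS; rewrite (submx_trans zS ST) in zT.
  by rewrite !nT.
have cardS : #|[set y | c y == c s]| = (p ^ \rank S - 1)%N.
  rewrite -card_sub_nonzero //; apply: eq_card => y; rewrite !inE /c sS (submx_trans sS ST).
  rewrite (negbTE s0) !xpair_eqE eqbF_neg !eqb_id andbAC [in RHS]andbC.
  by case: (boolP (y <= S)%MS) => [/submx_trans->|]; rewrite ?andbT ?andbF.
have cardT : #|[set y | c y == c t]| = (p ^ \rank T - p ^ \rank S)%N.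
  rewrite -!card_submx // -cardsDS; last first.
    by apply/subsetP=> y; rewrite !inE => /submx_trans->.
  apply: eq_card => y; rewrite !inE /c tT (negbTE t0) (negbTE tS).
  rewrite !xpair_eqE !eqbF_neg eqb_id.
  by case: eqP => [->|_] //=; rewrite sub0mx.
have cardW : #|[set y | c y == c w]| = (p ^ d - p ^ \rank T)%N.
  rewrite -card_sub_diff //; apply: eq_card => y; rewrite !inE /c (negbTE wT).
  rewrite (negbTE w0) (negbTE wS) !xpair_eqE !eqbF_neg.
  case: (boolP (y <= T)%MS) => [|yT]; rewrite ?andbF ?andbT //.
  apply/andP; split; first by apply: contraNneq yT => ->; apply: sub0mx.
  by apply: contra yT => yS; apply: submx_trans ST.
have card0 : #|[set y | c y == c 0]| = 1%N.
  transitivity #|[set (0 : 'rV['F_p]_d)]|; last exact: cards1.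
  apply: eq_card => y; rewrite !inE /c !sub0mx eqxx.
  by rewrite !xpair_eqE eqb_id; case: eqP => // ->; rewrite !sub0mx.
have ordh : #[lin h] = (p ^ d - p ^ \rank T)%N.
  rewrite -cardW -porbE; apply: eq_dvdn => m.
  rewrite -full_fixker // -sub_fixker //; apply/idP/idP => [|wk].
    exact: submx_full.
  by apply: spanV wk => //; apply: stable_fixker.
(* [n] is the common cycle length on the nonzero vectors of [S]. The map [phi] sends each of the
   three layers into the next lower one, which gives [phi3]. *)
pose n := (p ^ \rank S - 1)%N; pose phi := h ^+ n - 1%:M.
have Sphi : S *m phi = 0.
  apply/sub_kermxP/rV_subP => x xS; have [->|x0] := eqVneq x 0; first exact: sub0mx.
  rewrite sub_fixker // porbE.
  suff -> : c x = c s by rewrite cardS.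
  by rewrite /c xS sS !(submx_trans _ ST) // (negbTE x0) (negbTE s0).
have hphi : comm_mx phi h by apply: comm_exp_sub1.
have sphi : s *m phi = 0 by have /submxP[D ->] := sS; rewrite -mulmxA Sphi mulmx0.
have imT : (phi <= T)%MS.
  apply/negPn/negP => /exists_mem_diff[x xphi xT].
  have := spanV _ _ x (comm_mx_stable hphi) xT xphi.
  by rewrite row_full_unit => phiU; rewrite -[s](mulmxK phiU) sphi mul0mx eqxx in s0.
have TphiT : (T *m phi <= T)%MS by apply: submx_trans imT; apply: submxMl.
(* Otherwise T phi contains [T], so [phi] is injective on [T] by rank and nullity, against s phi =
   0. *)
have TphiS : (T *m phi <= S)%MS.
  apply/negPn/negP => /exists_mem_diff[x xphi xS].
  have hX : stablemx (T *m phi) h by rewrite -mulmxA hphi mulmxA submxMr.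
  have := spanT _ _ x hX (submx_trans xphi TphiT) xS xphi.
  move/mxrankS; rewrite -(mxrank_mul_ker T phi) -[X in (_ <= X)%N]addn0 leq_add2l.
  rewrite leqn0 mxrank_eq0 => /eqP cap0; case/negP: s0; rewrite -submx0 -cap0 sub_capmx.
  by rewrite (submx_trans sS ST); apply/sub_kermxP.
have phi3 : phi *m phi *m phi = 0.
  apply/eqP; rewrite -submx0 -Sphi submxMr //; apply: submx_trans TphiS.
  exact: submxMr.
have phiX m : (2 < m)%N -> phi ^+ m = 0.
  by case: m => [|[|[|m]]] // _; rewrite !expmxS !mulmxA phi3 mul0mx.
have hn : h ^+ n = 1%:M + phi by rewrite addrC subrK.
have dvd : (p ^ d - p ^ \rank T %| (if p == 2%N then 4 else p) * n)%N.
  (* The least power of [p] that is at least 3, as phi^3 = 0: it is 4 for p = 2 and [p]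
     otherwise. *)
  have [e eE lt_e] : exists2 e, (if p == 2%N then 4 else p) = (p ^ e)%N & (2 < p ^ e)%N.
    case: eqVneq => [->|np2]; first by exists 2%N.
    by exists 1%N; rewrite expn1 // ltn_neqAle eq_sym np2 prime_gt1.
  rewrite eE -ordh mulnC; apply/order_lin_dvdP => //.
  by rewrite exprM hn expmx1D_p // phiX // addr0.
have [p2 rS rT dE] := chain_dimensions p_prime S_gt0 ST_lt T_lt dvd.
have n1 : n = 1%N by rewrite /n rS p2.
have phiE : h = 1%:M + phi by rewrite -hn n1 expr1.
have pd : (p ^ d = 8)%N by transitivity (p ^ 3)%N; [congr (_ ^ _)%N | rewrite p2].
(* If phi^2 = 0, then h^2 = 1, but [h] has order 8 - 4 = 4. *)
have phi2 : phi *m phi != 0.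
  apply/eqP => phi20; have : (#[lin h] %| 2)%N.
    apply/order_lin_dvdP => //; have -> : 2%N = (p ^ 1)%N by rewrite p2.
    rewrite phiE expmx1D_p // expn1.
    have -> : phi ^+ p = phi *m phi by have -> : phi ^+ p = phi ^+ 2 by congr (_ ^+ _).
    by rewrite phi20 addr0.
  by rewrite ordh pd rT p2.
have [i ui] : exists i, delta_mx 0 i *m phi *m phi != 0 :> 'rV['F_p]_d.
  apply/existsP; apply: contraNT phi2; rewrite negb_exists => /forallP all0.
  apply/eqP/row_matrixP => i; rewrite row0 rowE mulmxA.
  exact/eqP/negPn/all0.
set u := delta_mx 0 i in ui.
(* phi^2 kills [T]; so [u] is outside [T], and the chain it generates spans everything. *)
have uT : ~~ (u <= T)%MS.
  apply: contra ui => uT; rewrite -submx0 -Sphi submxMr //.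
  by apply: submx_trans TphiS; apply: submxMr.
pose C : 'M['F_p]_(3, d) := \matrix_(k < 3) (u *m phi ^+ k).
have Ch : C *m h = J p 3 *m C by apply: jordan_chain => //; rewrite phiX ?mulmx0.
have /eqP rC : row_full C.
  apply: (spanV _ _ u) => //; first by rewrite Ch submxMl.
  by have := row_sub 0 C; rewrite rowK expr0 mulmx1.
exists 3%N, (J p 3), [:: 1; 1; 2; 4]%N; split; first exact: LinJ3.
  by exists C; split; rewrite // /row_free rC; apply/eqP.
have cS : #|[set y | c y == c s]| = 1%N by rewrite cardS rS p2.
have cT : #|[set y | c y == c t]| = 2%N by rewrite cardT rS rT p2.
have cW : #|[set y | c y == c w]| = 4%N by rewrite cardW pd rT p2.
by move: cyc; rewrite /= card0 cS cT cW.
Qed.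

End UniserialThree.

Lemma subn1_dvd_exp m n : m - 1 %| m ^ n - 1.
Proof. by rewrite !subn1 predn_exp dvdn_mulr. Qed.

(** Both numbers are divisible by p - 1 and by p^gcd(a,b) - 1. *)
Lemma gcdn_exp_sub1_eq1 p a b : prime p -> 0 < a -> 0 < b ->
  gcdn (p ^ a - 1) (p ^ b - 1) = 1 -> p = 2 /\ gcdn a b = 1.
Proof.
move=> p_prime a0 b0 gcd1; have p_gt1 := prime_gt1 p_prime.
have dvd1 m : m %| p ^ a - 1 -> m %| p ^ b - 1 -> m = 1.
  by move=> ma mb; apply/eqP; rewrite -dvdn1 -gcd1 dvdn_gcd ma.
have p2 : p = 2 by have := dvd1 _ (subn1_dvd_exp p a) (subn1_dvd_exp p b); lia.
split=> //; have gab k : gcdn a b %| k -> p ^ gcdn a b - 1 %| p ^ k - 1.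
  by case/dvdnP=> m ->; rewrite mulnC expnM subn1_dvd_exp.
have := dvd1 _ (gab _ (dvdn_gcdl a b)) (gab _ (dvdn_gcdr a b)).
have g0 : 0 < gcdn a b by rewrite gcdn_gt0 a0.
case: (gcdn a b) g0 => [|[|g]] // _; rewrite p2 !expnS.
by have := expn_gt0 2 g; lia.
Qed.

(** * Two stable subspaces that meet in 0 *)

Section DirectSums.

Variable p : nat.
Hypothesis p_prime : prime p.
Local Open Scope ring_scope.

Lemma lin_eq0 a (A : 'M['F_p]_a) x : A \in unitmx -> (lin A x == 0) = (x == 0).
Proof. by move=> AU; rewrite linE // mulmx_free_eq0 // row_free_unit. Qed.

Lemma exists_nonzero a : (0 < a)%N -> exists x : 'rV['F_p]_a, x != 0.
Proof.
case: a => // a _; exists (const_mx 1); apply/eqP => /rowP/(_ 0)/eqP.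
by rewrite !mxE oner_eq0.
Qed.

Lemma porbits_lin_ge2 a (A : 'M['F_p]_a) : A \in unitmx -> (0 < a)%N ->
  (2 <= #|porbits (lin A)|)%N.
Proof.
move=> AU /exists_nonzero[x x0].
apply: (@invariant_porbits _ _ (fun x => x == 0) _ [:: 0; x]).
  by move=> y; apply: lin_eq0.
by rewrite /= inE eqxx (negbTE x0).
Qed.

Lemma singer_two_orbits a (A : 'M['F_p]_a) : A \in unitmx -> (0 < a)%N ->
    (#|porbits (lin A)| <= 2)%N ->
  singer A /\ perm_eq (cycle_lengths (lin A)) [:: 1; p ^ a - 1]%N.
Proof.
move=> AU a0 le2; have [x x0] := exists_nonzero a0.
pose c (x : 'rV['F_p]_a) := x == 0.
have inv y : c (lin A y) = c y by apply: lin_eq0.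
have Uc : uniq (map c [:: 0; x]) by rewrite /c /= inE eqxx (negbTE x0).
have cyc := invariant_cycle_lengths inv Uc le2.
have card0 : #|[set y | c y == c 0]| = 1%N.
  transitivity #|[set (0 : 'rV['F_p]_a)]|; last exact: cards1.
  by apply: eq_card => y; rewrite !inE /c eqxx eqb_id.
have cardx y : y != 0 -> #|[set z | c z == c y]| = (p ^ a - 1)%N.
  move=> y0; have := cardC [set (0 : 'rV['F_p]_a)].
  rewrite cards1 card_mx card_Fp // mul1n => <-; rewrite addKn.
  by apply: eq_card => z; rewrite !inE /c (negbTE y0) eqbF_neg.
have cyc2 : perm_eq (cycle_lengths (lin A)) [:: 1; p ^ a - 1]%N.
  by move: cyc; rewrite /= card0 cardx.
split=> //; split=> //; rewrite (order_cycle_lengths cyc2) !big_cons big_nil.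
by rewrite lcmn1 lcm1n.
Qed.

Lemma leq_size_prod_lengths (L1 L2 : seq nat) :
  all (leq 1) L1 -> (size L1 * size L2 <= size (prod_lengths L1 L2))%N.
Proof.
move=> /allP pos1; rewrite size_prod_lengths -sum1_size big_distrl /=.
rewrite big_seq [leqRHS]big_seq; apply: leq_sum => l1 /pos1 l1_gt0.
rewrite mul1n -sum1_size; apply: leq_sum => l2 _.
by rewrite gcdn_gt0 l1_gt0.
Qed.

(** Each summand has at least two cycles and the product of the numbers is at most 4, so both are
    Singer cycles. The sum then has 3 + gcd(p^a - 1, p^b - 1) cycles, so this gcd is 1. *)
Lemma dsum_classified a b (A : 'M['F_p]_a) (B : 'M['F_p]_b) :
    A \in unitmx -> B \in unitmx -> (0 < a)%N -> (0 < b)%N ->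
  (#|porbits (lin (dsum A B))| <= 4)%N -> lin_classified (dsum A B).
Proof.
move=> AU BU a0 b0; rewrite -size_cycle_lengths => le4.
have szA := porbits_lin_ge2 AU a0; have szB := porbits_lin_ge2 BU b0.
have prod0 := lin_dsum_cycles AU BU (perm_refl _) (perm_refl _).
have := leq_size_prod_lengths (cycle_lengths (lin B)) (cycle_lengths_gt0 (lin A)).
rewrite -(perm_size prod0) !size_cycle_lengths => le_prod.
have [leA leB] : (#|porbits (lin A)| <= 2)%N /\ (#|porbits (lin B)| <= 2)%N.
  move: szA szB le_prod le4; rewrite size_cycle_lengths.
  move: #|porbits (lin A)| #|porbits (lin B)| #|porbits _| => {prod0} m n k.
  by clear; nia.
have [singA cycA] := singer_two_orbits AU a0 leA.
have [singB cycB] := singer_two_orbits BU b0 leB.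
have cyc := lin_dsum_cycles AU BU cycA cycB.
have [p2 gab] : p = 2%N /\ gcdn a b = 1%N.
  apply: gcdn_exp_sub1_eq1 => //; move: le4; rewrite (perm_size cyc).
  rewrite size_prod_lengths !big_cons !big_nil !gcd1n !gcdn1 !addn0 !add1n !ltnS.
  have : (0 < gcdn (p ^ a - 1) (p ^ b - 1))%N.
    by rewrite gcdn_gt0 subn_gt0 -{1}(expn0 p) ltn_exp2l ?a0 // prime_gt1.
  by move: (gcdn _ _) => m; clear; lia.
have gcd1 : gcdn (p ^ a - 1) (p ^ b - 1) = 1%N.
  move: le4; rewrite (perm_size cyc).
  rewrite size_prod_lengths !big_cons !big_nil !gcd1n !gcdn1 !addn0 !add1n !ltnS.
  have : (0 < gcdn (p ^ a - 1) (p ^ b - 1))%N.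
    by rewrite gcdn_gt0 subn_gt0 -{1}(expn0 p) ltn_exp2l ?a0 // prime_gt1.
  by move: (gcdn _ _) => m; clear; lia.
have {}cyc : perm_eq (cycle_lengths (lin (dsum A B)))
    [:: 1; 2 ^ a - 1; 2 ^ b - 1; (2 ^ a - 1) * (2 ^ b - 1)]%N.
  apply: (perm_trans cyc); rewrite /prod_lengths /= gcd1.
  have -> : lcmn (p ^ a - 1) (p ^ b - 1) = ((p ^ a - 1) * (p ^ b - 1))%N.
    by rewrite -muln_lcm_gcd gcd1 muln1.
  rewrite !gcd1n !gcdn1 !lcm1n !lcmn1 p2 /=.
  by rewrite perm_cons (perm_catCA [:: _] [:: _]).
have [ab3 | ab3] := leqP 3 (a + b).
  exists (a + b)%N, (dsum A B), [:: 1; 2 ^ a - 1; 2 ^ b - 1; (2 ^ a - 1) * (2 ^ b - 1)]%N.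
  by split; [exact: LinSum | exact: lsim_refl | exact: cyc].
(* The remaining map is the identity of F_2^2, listed as the cube of a Singer cycle of degree 2. *)
have [a1 b1] : a = 1%N /\ b = 1%N by move: a0 b0 ab3; clear; lia.
move: A B AU BU singA singB cyc {szA szB prod0 le_prod leA leB le4 cycA cycB}.
rewrite {}a1 {}b1 => A B AU BU [_ _ ordA] [_ _ ordB] cyc.
have one C : C \in unitmx -> #[lin C] = (p ^ 1 - 1)%N -> C = 1%:M :> 'M['F_p]_1.
  move=> CU ordC; apply/eqP; have : (#[lin C] %| 1)%N by rewrite ordC p2.
  by move/order_lin_dvdP => /(_ CU); rewrite expr1 => ->.
exists (1 + 1)%N, (fib_mx p ^+ 3), (1 :: nseq 3 ((p ^ 2 - 1) %/ 3))%N; split.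
- by apply: LinSinger; rewrite ?p2 //; apply: singer_fib.
- rewrite fib_mx_exp3 // (one A) // (one B) // /dsum -scalar_mx_block.
  exact: lsim_refl.
by apply: (perm_trans cyc); rewrite p2.
Qed.

Lemma lin_classified_lsim n d (h0 : 'M['F_p]_n) (h : 'M['F_p]_d) :
  h \in unitmx -> lsim h0 h -> lin_classified h0 -> lin_classified h.
Proof.
move=> hU sim [m [h1 [l [cl sim1 cyc]]]]; exists m, h1, l; split=> //.
  exact: lsim_trans sim1 sim.
exact: perm_trans (lsim_cycles hU sim) cyc.
Qed.

Lemma complemented_classified d (h S T : 'M['F_p]_d) :
    h \in unitmx -> stablemx S h -> stablemx T h ->
    (#|porbits (lin h)| <= 4)%N -> S != 0 -> T != 0 -> (S :&: T)%MS = 0 ->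
  lin_classified h.
Proof.
move=> hU hS hT few S0 T0 ST0.
have [s sS s0] := nonzero_mem S0; have [t tT t0] := nonzero_mem T0.
have disj x : (x <= S)%MS -> (x <= T)%MS -> x = 0 :> 'rV['F_p]_d.
  by move=> xS xT; apply/eqP; rewrite -submx0 -ST0 sub_capmx xS.
have full : \rank (S + T)%MS = d.
  apply/eqP; apply: contraT => nfull.
  have [w _ wST] : exists2 w : 'rV['F_p]_d, (w <= (1%:M : 'M['F_p]_d))%MS
      & ~~ (w <= S + T)%MS.
    by apply: exists_mem_diff; rewrite sub1mx.
  have hST : stablemx (S + T)%MS h by apply: stableDmx.
  (* If [S + T] were proper, then 0, [s], [t], [s + t] and [w] would lie in five different
     cycles. *)
  pose c (x : 'rV['F_p]_d) := (x == 0, (x <= S)%MS, (x <= T)%MS, (x <= S + T)%MS).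
  have := few; rewrite leqNgt (@invariant_porbits _ _ c _ [:: 0; s; t; s + t; w]) //.
    by move=> x; rewrite /c lin_eq0 // !stable_mem.
  have tS : (t <= S)%MS = false by apply: contraNF t0 => /disj->.
  have sT : (s <= T)%MS = false by apply: contraNF s0 => /disj->.
  have stS : ((s + t)%R <= S)%MS = false.
    by apply: contraFF tS => st; rewrite -[t](addKr s); apply: addmx_sub; rewrite ?eqmx_opp.
  have stT : ((s + t)%R <= T)%MS = false.
    by apply: contraFF sT => st; rewrite -[s](addrK t); apply: addmx_sub; rewrite ?eqmx_opp.
  have st0 : (s + t == 0) = false.
    by apply: contraFF stS => /eqP->; apply: sub0mx.
  have stST : ((s + t)%R <= S + T)%MS by apply: addmx_sub_adds.
  have wS : (w <= S)%MS = false.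
    by apply: contraNF wST => wS; apply: submx_trans (addsmxSl _ _).
  have wT : (w <= T)%MS = false.
    by apply: contraNF wST => wT; apply: submx_trans (addsmxSr _ _).
  have w0 : (w == 0) = false by apply: contraFF wS => /eqP->; apply: sub0mx.
  rewrite /c /= !inE !sub0mx eqxx (negbTE s0) (negbTE t0) sS tT tS sT stS stT.
  by rewrite st0 wS wT w0 stST (negbTE wST) (submx_trans sS (addsmxSl _ _)).
have base (X : 'M['F_p]_d) : stablemx X h ->
    row_base X *m h = row_base X *m h *m pinvmx (row_base X) *m row_base X.
  by move=> hX; rewrite mulmxKpV // stablemx_row_base.
have sim : lsim (dsum (row_base S *m h *m pinvmx (row_base S))
                      (row_base T *m h *m pinvmx (row_base T))) h.
  have rST := mxrank_sum_cap S T; rewrite ST0 mxrank0 addn0 full in rST.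
  exists (col_mx (row_base S) (row_base T)); split=> //.
    by rewrite /row_free -addsmxE (adds_eqmx (eq_row_base S) (eq_row_base T)) full; apply/eqP.
  by rewrite mul_col_mx /dsum mul_block_col !mul0mx add0r addr0 -!base.
have := lsim_unit sim; rewrite hU unitmx_dsum => /andP[AU BU].
apply: (lin_classified_lsim hU sim); apply: dsum_classified => //.
- by rewrite lt0n mxrank_eq0.
- by rewrite lt0n mxrank_eq0.
by rewrite -size_cycle_lengths -(perm_size (lsim_cycles hU sim)) size_cycle_lengths.
Qed.

End DirectSums.

(* Write [y = x ^+ (r k)]: one of [k], [k + n] is coprime to [r] as well, because
   [r] is 1 or a prime. *)
Lemma cyclic_root (gT : finGroupType) (x y : gT) r n :
    0 < n -> #[x] = r * n -> y \in <[x]> -> #[y] = n -> r \in [:: 1; 2; 3] ->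
  exists2 z, #[z] = r * n & (z ^+ r)%g = y.
Proof.
move=> n0 ox /cycleP[j ->]; rewrite orderXgcd ox => oj r123.
have r0 : 0 < r by move: r123; rewrite !inE; lia.
have rn0 : 0 < r * n by rewrite muln_gt0 r0.
have gE : gcdn (r * n) j = r.
  have g0 : 0 < gcdn (r * n) j by rewrite gcdn_gt0 rn0.
  apply/eqP; rewrite -(eqn_pmul2r n0) mulnC -{1}oj divnK ?dvdn_gcdl //.
have /dvdnP[k jE] : r %| j by rewrite -gE dvdn_gcdr.
have cop : coprime n k.
  by move/eqP: gE; rewrite jE [k * r]mulnC -muln_gcdr -[X in _ == X]muln1 eqn_pmul2l.
pose e := k + (r %| k) * n.
have nE : coprime n e by rewrite /coprime /e addnC gcdnMDl.
have rE : coprime r e.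
  have [r1 | r_prime] : r = 1 \/ prime r.
    by move: r123; rewrite !inE => /or3P[] /eqP->; [left | right | right].
    by rewrite r1 coprime1n.
  rewrite prime_coprime // /e; case: (boolP (r %| k)) => [rk | nrk]; last by rewrite addn0.
  rewrite mul1n dvdn_addr //; apply/negP => rn.
  have : r %| 1 by rewrite -(eqP cop) dvdn_gcd rn rk.
  by rewrite dvdn1 => /eqP r1; rewrite r1 in r_prime.
exists (x ^+ e)%g.
  by rewrite orderXgcd ox (eqP (_ : coprime (r * n) e)) ?divn1 // coprimeMl rE.
rewrite -expgM jE; apply/eqP; rewrite eq_expg_mod_order ox /e mulnDl.
by rewrite -mulnA [n * r]mulnC addnC modnMDl.
Qed.

(** * No proper nonzero stable subspace *)

Section SimpleModule.

Variable p : nat.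
Hypothesis p_prime : prime p.
Local Open Scope ring_scope.

Variables (d' : nat).
Local Notation d := d'.+1.
Variable h : 'M['F_p]_d.
Hypothesis h_unit : h \in unitmx.
Hypothesis simple :
  forall X : 'M['F_p]_d, stablemx X h -> X != 0 -> row_full X.

(** The span of the iterates of [w] is stable; exponents below the order of [h] suffice. A matrix
    commuting with [h] is thus determined by the image of one vector. *)
Lemma krylov (w v : 'rV['F_p]_d) : w != 0 ->
  exists c : 'I_#[lin h] -> 'F_p, v = \sum_i c i *: (w *m h ^+ i).
Proof.
move=> w0; pose K : 'M['F_p]_(#[lin h], d) := \matrix_i (w *m h ^+ i).
have hK : stablemx K h.
  apply/row_subP => i; rewrite row_mul rowK -mulmxA -expmxSr.
  have lt : (i.+1 %% #[lin h] < #[lin h])%N by rewrite ltn_mod order_gt0.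
  rewrite (_ : w *m _ = row (Ordinal lt) K) ?row_sub // rowK /=.
  by rewrite -!linXE // expg_mod_order.
have wK : (w <= K)%MS.
  rewrite (_ : w = row (Ordinal (order_gt0 (lin h))) K) ?row_sub // rowK.
  by rewrite expr0 mulmx1.
have full : row_full <<K>>%MS.
  apply: simple; first by rewrite (eqmx_stable _ (genmxE K)).
  apply: contraNneq w0 => K0.
  have : (w <= <<K>>)%MS by rewrite genmxE.
  by rewrite K0 submx0.
have /submxP[c ->] : (v <= K)%MS.
  by apply: submx_trans (submx_full v full) _; rewrite genmxE.
by exists (c 0); rewrite mulmx_sum_row; apply: eq_bigr => i _; rewrite rowK.
Qed.

Lemma commuting_unit (x : 'M['F_p]_d) : comm_mx x h -> x != 0 -> x \in unitmx.
Proof.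
move=> xh x0; have := simple (comm_mx_stable xh) x0; by rewrite row_full_unit.
Qed.

(** On [w] both [x] and [y] agree with polynomials in [h], so the commutator kills [w]. It commutes
    with [h], and by [commuting_unit] it would be invertible if it were nonzero. *)
Lemma commuting_comm (x y : 'M['F_p]_d) : comm_mx x h -> comm_mx y h -> comm_mx x y.
Proof.
move=> xh yh; apply/eqP; rewrite -subr_eq0; apply: contraT => z0.
have zh : comm_mx (x *m y - y *m x) h.
  by apply: comm_mx_sym; apply: comm_mxB; apply: comm_mxM; apply: comm_mx_sym.
pose w : 'rV['F_p]_d := delta_mx 0 0.
have w0 : w != 0 by apply/eqP => /rowP/(_ 0)/eqP; rewrite !mxE oner_eq0.
have [c wx] := krylov (w *m x) w0; have [b wy] := krylov (w *m y) w0.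
have comX z i : comm_mx z h -> h ^+ i *m z = z *m h ^+ i.
  by move=> zc; symmetry; apply: comm_mulmxX.
suff : w *m (x *m y - y *m x) == 0.
  by rewrite mulmx_free_eq0 ?row_free_unit ?commuting_unit // (negbTE w0).
rewrite mulmxBr !mulmxA wx wy !mulmx_suml subr_eq0; apply/eqP.
under eq_bigr => i _ do rewrite -scalemxAl -mulmxA comX // mulmxA wy mulmx_suml scaler_sumr.
under [RHS]eq_bigr => i _ do rewrite -scalemxAl -mulmxA comX // mulmxA wx mulmx_suml scaler_sumr.
rewrite exchange_big; apply: eq_bigr => i _; apply: eq_bigr => j _.
by rewrite -!scalemxAl !scalerA mulrC -!mulmxA -!expmxD addnC.
Qed.

Lemma order_lin_GL (x : {'GL_d['F_p]}) : #[lin (val x)] = #[x].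
Proof.
have xU : val x \in unitmx by apply: valP.
apply: eq_dvdn => n; rewrite [RHS]order_dvdn; apply/(order_lin_dvdP _ xU)/eqP.
  by move=> xn; apply: val_inj; rewrite FinRing.val_unitX.
by move=> xn; rewrite -FinRing.val_unitX xn.
Qed.

(** The centralizer of [h] serves as the multiplicative group of a field without the field being
    built: it is cyclic of order p^d - 1, and an element of order (p^d - 1) / r in it is the r-th
    power of a generator. *)
Lemma singer_root r : (p ^ d - 1 = r * #[lin h])%N -> r \in [:: 1; 2; 3]%N ->
  exists2 s : 'M['F_p]_d, singer s & s ^+ r = h.
Proof.
move=> cardr r123; pose hG : {'GL_d['F_p]} := FinRing.unit 'M['F_p]_d h_unit.
pose G := 'C[hG]%G.
have inG (x : {'GL_d['F_p]}) : (x \in G) = (comm_mxb (val x) h).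
  rewrite cent1E; apply/eqP/eqP => [/(congr1 val) // | xh].
  exact: val_inj.
have abelG : abelian G.
  apply/centsP => x; rewrite inG => /eqP xh y; rewrite inG => /eqP yh.
  by apply: val_inj; apply: commuting_comm.
have cycG : cyclic G.
  have := @div_ring_mul_group_cyclic _ G 'M['F_p]_d val.
  apply=> // x.
  rewrite in_setD1 => /andP[x1]; rewrite inG => /eqP xh.
  apply: commuting_unit.
    by rewrite /comm_mx mulmxBl mulmxBr mul1mx mulmx1 xh.
  by rewrite subr_eq0; apply: contraNneq x1 => x1; apply/eqP/val_inj.
pose w : 'rV['F_p]_d := delta_mx 0 0.
have w0 : w != 0 by apply/eqP => /rowP/(_ 0)/eqP; rewrite !mxE oner_eq0.
(* x |-> w x maps the centralizer bijectively onto the nonzero vectors; surjectivity is [krylov]. *)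
have cardG : #|G| = (p ^ d - 1)%N.
  have inj : {in G &, injective (fun x : {'GL_d['F_p]} => w *m val x)}.
    move=> x y; rewrite !inG => /eqP xh /eqP yh /eqP exy; apply/val_inj/eqP.
    rewrite -subr_eq0; apply: contraT => z0; move: exy; rewrite -subr_eq0 -mulmxBr.
    rewrite mulmx_free_eq0 ?(negbTE w0) // row_free_unit commuting_unit //.
    by rewrite /comm_mx mulmxBl mulmxBr xh yh.
  have := card_sub_nonzero p_prime (1%:M : 'M['F_p]_d); rewrite mxrank1 => <-.
  rewrite -(card_in_imset inj).
  apply: eq_card => v; rewrite inE submx1; apply/imsetP/idP => [[x xG ->] | v0].
    by rewrite mulmx_free_eq0 // row_free_unit; apply: valP.
  have [c vE] := krylov v w0; pose z := \sum_i c i *: h ^+ i.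
  have vz : v = w *m z.
    by rewrite vE mulmx_sumr; apply: eq_bigr => i _; rewrite scalemxAr.
  have zh : comm_mx z h.
    rewrite /comm_mx mulmx_suml mulmx_sumr; apply: eq_bigr => i _.
    by rewrite -scalemxAl -scalemxAr -expmxSr -expmxS.
  have z0 : z != 0 by apply: contraTneq v0 => z0; rewrite vz z0 mulmx0 eqxx.
  exists (FinRing.unit 'M['F_p]_d (commuting_unit zh z0)) => //.
  by rewrite inG; apply/eqP.
have /cyclicP[x Gx] := cycG.
have hGG : hG \in G by rewrite inG; apply/eqP.
have ordh : #[hG] = #[lin h] by rewrite -order_lin_GL.
have ordx : #[x] = (r * #[lin h])%N by rewrite -cardr -cardG Gx.
have hGx : hG \in <[x]>%g by rewrite -Gx.
have [z ordz zr] := cyclic_root (order_gt0 (lin h)) ordx hGx ordh r123.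
exists (val z); last by rewrite -FinRing.val_unitX zr.
split=> //; first exact: valP.
by rewrite order_lin_GL ordz -cardr.
Qed.

Lemma simple_classified_pos : (#|porbits (lin h)| <= 4)%N -> lin_classified h.
Proof.
move=> few; set L := #[lin h].
have len x : x != 0 -> #|porbit (lin h) x| = L.
  move=> x0; apply: eq_dvdn => m; rewrite -sub_fixker // -full_fixker //.
  apply/idP/idP => [xk | ]; last exact: submx_full.
  apply: simple; first exact: stable_fixker.
  by apply: contraNneq x0 => k0; rewrite k0 submx0 in xk.
have h1 : stablemx (1%:M : 'M['F_p]_d) h by rewrite mul1mx submx1.
have := card_porbits_split h_unit h1.
set A := [set x | _]; set r := orbit_count _ A => porbE.
have cardA : (p ^ d - 1 = r * L)%N.
  have := card_sub_nonzero p_prime (1%:M : 'M['F_p]_d); rewrite mxrank1 => <-.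
  apply: card_const_orbits => x; rewrite inE; last by case/andP=> _; apply: len.
  by rewrite inE !submx1 linE // mulmx_free_eq0 // row_free_unit.
have r0 : (0 < r)%N.
  have : (0 < p ^ d - 1)%N by rewrite subn_gt0 -{1}(expn0 p) ltn_exp2l // prime_gt1.
  by rewrite cardA muln_gt0 => /andP[].
have r3 : (r <= 3)%N.
  by rewrite -ltnS; apply: leq_trans few; rewrite porbE -addnA add1n ltnS leq_addr.
have [s sing sr] : exists2 s : 'M['F_p]_d, singer s & s ^+ r = h.
  apply: singer_root => //; move: r0 r3; clear; rewrite !inE.
  by case: r => [|[|[|[|r]]]].
have L0 : (0 < L)%N by apply: order_gt0.
exists d, (s ^+ r), (1 :: nseq r ((p ^ d - 1) %/ r))%N; split.
- by apply: LinSinger; rewrite ?r0 // cardA dvdn_mulr.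
- by rewrite sr; apply: lsim_refl.
rewrite cardA mulKn //.
(* With the whole space as [S] the outer layer is empty: 0 cycles of the dummy length 1. *)
have := @cycle_lengths_flag _ p_prime _ h 1%:M h_unit h1 r 0 L 1.
rewrite mxrank1 cats0; apply=> //; rewrite ?subnn //.
  by move=> x _; apply: len.
by move=> x; rewrite submx1.
Qed.

End SimpleModule.

Lemma simple_classified p d (h : 'M['F_p]_d) : prime p -> (0 < d)%N ->
    h \in unitmx ->
    (forall X : 'M['F_p]_d, stablemx X h -> X != 0%R -> row_full X) ->
  (#|porbits (lin h)| <= 4)%N -> lin_classified h.
Proof. by case: d h => // d h p_prime _; apply: simple_classified_pos. Qed.

Theorem linear_classification p d (h : 'M['F_p]_d) : prime p -> 0 < d ->
  h \in unitmx -> #|porbits (lin h)| <= 4 -> lin_classified h.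
Proof.
move=> p_prime d_gt0 h_unit few.
have [/existsP[S /existsP[T /and5P[hS hT S0 T0 /eqP ST0]]] | meet] :=
    boolP [exists S : 'M['F_p]_d, exists T : 'M['F_p]_d,
      [&& stablemx S h, stablemx T h, S != 0%R, T != 0%R & (S :&: T)%MS == 0%R]].
  exact: complemented_classified ST0.
have one0 : (1%:M : 'M['F_p]_d)%R != 0%R by rewrite -mxrank_eq0 mxrank1 -lt0n.
have [|S /andP[hS S0] minS] := @arg_minnP _ (1%:M : 'M['F_p]_d)%R
  (fun X => stablemx X h && (X != 0%R)) (fun X => \rank X).
  by rewrite mul1mx submx1.
(* Intersections with [S] are nonzero, so minimal rank makes [S] least. *)
have {meet}minS (X : 'M['F_p]_d) : stablemx X h -> X != 0%R -> (S <= X)%MS.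
  move=> hX X0; have hSX : stablemx (S :&: X)%MS h.
    rewrite sub_capmx (submx_trans _ hS) ?submxMr ?capmxSl //.
    by rewrite (submx_trans _ hX) ?submxMr ?capmxSr.
  have SX0 : (S :&: X)%MS != 0%R.
    apply: contraNneq meet => SX0; apply/existsP; exists S; apply/existsP; exists X.
    by rewrite hS hX S0 X0 SX0 eqxx.
  have := minS (S :&: X)%MS; rewrite hSX SX0 => /(_ isT) le_rank.
  have /eqmxP eqS : (S :&: X == S)%MS.
    rewrite -(mxrank_leqif_eq (capmxSl S X)).2 eqn_leq le_rank andbT.
    exact: mxrankS (capmxSl S X).
  by rewrite -eqS capmxSr.
have S_gt0 : 0 < \rank S by rewrite lt0n mxrank_eq0.
have [S_full | S_lt] := leqP d (\rank S).
  apply: simple_classified => // X hX X0.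
  apply/eqP/anti_leq; rewrite rank_leq_col.
  by apply: leq_trans S_full _; apply/mxrankS/minS.
have [/existsP[T /and4P[hT ST ST_lt T_lt]] | noT] :=
    boolP [exists T : 'M['F_p]_d,
      [&& stablemx T h, (S <= T)%MS, \rank S < \rank T & \rank T < d]].
  exact: (uniserial_three_classified p_prime h_unit hS hT few S_gt0 ST ST_lt T_lt).
apply: (uniserial_two_classified p_prime h_unit hS few S_gt0 S_lt) => // X hX XS.
have X0 : X != 0%R by apply: contraNneq XS => ->; apply: sub0mx.
have SX := minS X hX X0.
apply: contraR noT => nfull; apply/existsP; exists X; rewrite hX SX /=.
rewrite ltn_neqAle [X in _ && X]ltn_neqAle rank_leq_col mxrankS // nfull !andbT.
by apply: contra XS => eqr; move: eqr; rewrite (mxrank_leqif_eq SX) => /andP[].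
Qed.

(** * Assembling the list *)

Definition listed p d (v : 'rV['F_p]_d) (h : 'M['F_p]_d) :=
  exists (v0 : 'rV['F_p]_d) (h0 : 'M['F_p]_d) (c : nat) (l : seq nat),
    [/\ classified v0 h0 c l,
        (transl v * lin h)%g \in ((transl v0 * lin h0) ^: AGL p d)%g,
        #[transl v * lin h]%g = c * #[lin h]%g &
        perm_eq (cycle_lengths (transl v * lin h)%g) l].

Lemma classified_listed p d n (v0 : 'rV['F_p]_n) h0 c l (v : 'rV['F_p]_d) h :
    h \in unitmx -> classified v0 h0 c l -> affsim v0 h0 v h ->
    #[transl v0 * lin h0]%g = c * #[lin h0] ->
    perm_eq (cycle_lengths (transl v0 * lin h0)%g) l ->
  listed v h.
Proof.
move=> hU cl sim; have [P [x0 [nd _ _ _]]] := sim.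
move: v0 h0 cl sim {P x0}; rewrite {n}nd => v0 h0 cl sim ordc cyc.
exists v0, h0, c, l; split=> //; first exact: affsim_class.
  by rewrite (affsim_order hU sim) (lsim_order hU (affsim_lsim sim)).
exact: perm_trans (affsim_cycles hU sim) cyc.
Qed.

Lemma lin_class_classified p d (h : 'M['F_p]_d) l :
  lin_class h l -> classified 0%R h 1 l.
Proof.
case: d h l / => [d i s | s | a1 a2 s1 s2 | | s].
- exact: A1.
- exact: A2.
- move=> p2; move: s1 s2; rewrite p2 => s1 s2.
  exact: B1.
- by move=> ->; apply: C5.
by move=> p2; move: s; rewrite p2 => s; apply: C7.
Qed.

Lemma prod_lengths_nseq N q L :
  prod_lengths (nseq N q) L =
  flatten (nseq N (flatten [seq nseq (gcdn q l) (lcmn q l) | l <- L])).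
Proof.
rewrite /prod_lengths; elim: N => //= N IHN.
by rewrite flatten_cat IHN.
Qed.

(** p^e is the cycle length of t_{e_1} J_k and p^e' the order of J_k; the equation between the two
    [lcmn] is what determines [c]. *)
Lemma jordan_sum_listed p k e e' m (h0 : 'M['F_p]_m) L n v1 (h1 : 'M['F_p]_n) c l
    d v (h : 'M['F_p]_d) :
    prime p -> 0 < k -> p ^ e.-1 <= k < p ^ e ->
    k <= p ^ e' -> (0 < e' -> p ^ e'.-1 < k) ->
    h0 \in unitmx -> perm_eq (cycle_lengths (lin h0)) L -> h \in unitmx ->
    affsim (row_mx (e_ p k 1) 0%R) (dsum (J p k) h0) v h ->
    affsim v1 h1 (row_mx (e_ p k 1) 0%R) (dsum (J p k) h0) ->
    classified v1 h1 c l ->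
    lcmn (p ^ e) #[lin h0] = c * lcmn (p ^ e') #[lin h0] ->
    perm_eq (prod_lengths (nseq (p ^ (k - e)) (p ^ e)) L) l ->
  listed v h.
Proof.
move=> p_prime k_gt0 ek e'k e'k' h0U cyc0 hU sim sim1 cl lcmE perml.
have JU : J p k \in unitmx by apply: J_unit.
have U : dsum (J p k) h0 \in unitmx by rewrite unitmx_dsum JU.
have cycJ := transl_J_cycles p_prime k_gt0 ek.
have cyc0' : perm_eq (cycle_lengths (transl 0%R * lin h0)%g) L.
  by rewrite transl0 mul1g.
have cyc := affine_dsum_cycles JU h0U cycJ cyc0'.
apply: (classified_listed hU cl (affsim_trans sim1 sim)).
  rewrite -(affsim_order U sim1) -(lsim_order U (affsim_lsim sim1)).
  rewrite order_affine_dsum // order_lin_dsum // (order_J p_prime e'k e'k') -lcmE.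
  congr (lcmn _ _); rewrite (order_cycle_lengths cycJ) big_nseq.
  have : 0 < p ^ (k - e) by rewrite expn_gt0 prime_gt0.
  case: (p ^ (k - e)) => // N _; elim: N => [|N /= ->]; first exact: lcmn1.
  exact/lcmn_idPr/dvdnn.
apply: perm_trans perml; apply: perm_trans cyc; rewrite perm_sym.
exact: affsim_cycles.
Qed.

(** Write k = t + 1 + c with [t] the truncated logarithm: p^c <= 4 bounds [c], and then p^t <= t + 1
    + c bounds [t]. *)
Lemma small_jordan_blocks p k : prime p -> 0 < k ->
    p ^ (k - (trunc_log p k).+1) <= 4 ->
  [\/ k = 1,
      p = 2 /\ k \in [:: 2; 3; 4; 5] | p = 3 /\ k \in [:: 2; 3]].
Proof.
move=> p_prime k_gt0; have p_gt1 := prime_gt1 p_prime.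
have /andP[] := trunc_log_bounds p_gt1 k_gt0.
move: (trunc_log p k) => t le_k lt_k le4.
have lt_tk : t < k by apply: leq_trans le_k; apply: ltn_expl.
have [c kE] : exists c, k = t.+1 + c by exists (k - t.+1); rewrite subnKC.
move: le4; rewrite kE addKn => le4.
have ge_pt : 0 < t -> p * t <= p ^ t.
  case: {le_k lt_k lt_tk kE} t => // t _.
  by rewrite expnS leq_mul2l orbC ltn_expl.
have c_lt : c < p ^ c by apply: ltn_expl.
have le_pt : p ^ t <= t + c.+1 by lia.
have [p5 | p_lt5] := leqP 5 p.
  have c0 : c = 0.
    case: c le4 {kE c_lt le_pt} => // c; rewrite expnS => le4.
    by have := expn_gt0 p c; nia.
  constructor 1; rewrite c0.
  by case: t le_pt ge_pt {lt_k lt_tk le_k kE} => // t le_pt /(_ isT); nia.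
have p_alt : p = 2 \/ p = 3.
  by case: p p_prime p_lt5 {p_gt1 le_k lt_k lt_tk le4 ge_pt c_lt le_pt} => [|[|[|[|[|p]]]]] //; auto.
case: p_alt => pE; rewrite pE {p_prime p_gt1 p_lt5} in le_k lt_k le4 ge_pt c_lt le_pt *.
  have c2 : c <= 2 by move: le4; rewrite -[4]/(2 ^ 2) leq_exp2l.
  have t3 : t <= 3 by case: t ge_pt le_pt {le_k lt_k lt_tk kE} => // t /(_ isT); nia.
  case: t t3 le_k lt_k kE {lt_tk ge_pt le_pt} => [|[|[|[|//]]]] _ le_k lt_k kE.
  - by constructor 1; move: lt_k; rewrite kE /=; lia.
  - by constructor 2; split=> //; move: lt_k; rewrite kE; case: c c2 {kE le_k le4 c_lt} => [|[|[|]]].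
  - by constructor 2; split=> //; move: lt_k le_k; rewrite kE; case: c c2 {kE le4 c_lt} => [|[|[|]]].
  by move: le_k; rewrite kE /=; lia.
have c1 : c <= 1 by rewrite leqNgt; apply/negP => c2; have : 3 ^ 2 <= 3 ^ c by [rewrite leq_exp2l]; lia.
have t1 : t <= 1 by case: t ge_pt le_pt {le_k lt_k lt_tk kE} => // t /(_ isT); nia.
case: t t1 le_k lt_k kE {lt_tk ge_pt le_pt} => [|[|//]] _ le_k lt_k kE.
  by case: c c1 {kE le_k lt_k le4 c_lt} => [|[|]] // _; [constructor 1 | constructor 3].
by move: lt_k le_k; rewrite kE; case: c c1 {kE le4 c_lt} => [|[|]] //; constructor 3.
Qed.

Lemma coprime_biglcm q (L : seq nat) :
  all (coprime q) L -> coprime q (\big[lcmn/1]_(l <- L) l).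
Proof.
elim: L => [|l L IHL] /=; first by rewrite big_nil coprimen1.
case/andP=> cl /IHL cL; rewrite big_cons; apply: (@coprime_dvdr _ (l * \big[lcmn/1]_(x <- L) x)).
  by rewrite dvdn_lcm dvdn_mulr // dvdn_mull.
by rewrite coprimeMr cl.
Qed.

Lemma lcmn_coprime m n : coprime m n -> lcmn m n = m * n.
Proof. by move=> /eqP cmn; rewrite -muln_lcm_gcd cmn muln1. Qed.

Lemma prod_lengths_coprime N q L : all (coprime q) L ->
  prod_lengths (nseq N q) L = flatten (nseq N [seq q * l | l <- L]).
Proof.
move=> /allP cL; rewrite prod_lengths_nseq; congr (flatten (nseq _ _)).
elim: L cL => //= l L IHL cL; rewrite IHL; last first.
  by move=> x Lx; apply: cL; rewrite inE Lx orbT.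
by have cl := cL l (mem_head _ _); rewrite lcmn_coprime // (eqP cl).
Qed.

Lemma coprime_exp_sub1 p m : prime p -> 0 < m -> coprime p (p ^ m - 1).
Proof.
move=> p_prime m_gt0; rewrite prime_coprime //; apply/negP => dvd.
have : p %| 1.
  rewrite -(dvdn_addr _ dvd) subnK ?expn_gt0 ?prime_gt0 //.
  by case: m m_gt0 {dvd} => // m _; rewrite expnS dvdn_mulr.
by rewrite dvdn1 => /eqP p1; rewrite p1 in p_prime.
Qed.

Lemma jordan_coprime_listed p k e e' m (h0 : 'M['F_p]_m) L n v1 (h1 : 'M['F_p]_n) c l
    d v (h : 'M['F_p]_d) :
    prime p -> 0 < k -> p ^ e.-1 <= k < p ^ e ->
    k <= p ^ e' -> (0 < e' -> p ^ e'.-1 < k) ->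
    h0 \in unitmx -> perm_eq (cycle_lengths (lin h0)) L -> h \in unitmx ->
    affsim (row_mx (e_ p k 1) 0%R) (dsum (J p k) h0) v h ->
    affsim v1 h1 (row_mx (e_ p k 1) 0%R) (dsum (J p k) h0) ->
    classified v1 h1 c l -> all (coprime p) L -> p ^ e = c * p ^ e' ->
    perm_eq (flatten (nseq (p ^ (k - e)) [seq p ^ e * x | x <- L])) l ->
  listed v h.
Proof.
move=> p_prime k_gt0 ek e'k e'k' h0U cyc hU sim sim1 cl cL eE perml.
have cLX j : all (coprime (p ^ j)) L by apply: sub_all cL => x; apply: coprimeXl.
apply: (jordan_sum_listed p_prime k_gt0 ek e'k e'k' h0U cyc hU sim sim1 cl).
  rewrite (order_cycle_lengths cyc) !lcmn_coprime ?coprime_biglcm //.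
  by rewrite eE mulnA.
by rewrite prod_lengths_coprime.
Qed.

Lemma pure_jordan_listed p k e e' c l d v (h : 'M['F_p]_d) :
    prime p -> 0 < k -> p ^ e.-1 <= k < p ^ e ->
    k <= p ^ e' -> (0 < e' -> p ^ e'.-1 < k) -> h \in unitmx ->
    affsim (e_ p k 1) (J p k) v h -> classified (e_ p k 1) (J p k) c l ->
    p ^ e = c * p ^ e' -> l = nseq (p ^ (k - e)) (p ^ e) ->
  listed v h.
Proof.
move=> p_prime k_gt0 ek e'k e'k' hU sim cl eE lE.
have cyc := transl_J_cycles p_prime k_gt0 ek.
apply: (classified_listed hU cl sim); last by rewrite lE.
rewrite (order_J p_prime e'k e'k') -eE (order_cycle_lengths cyc) big_nseq.
have : 0 < p ^ (k - e) by rewrite expn_gt0 prime_gt0.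
case: (p ^ (k - e)) => // N _; elim: N => [|N /= ->]; first exact: lcmn1.
exact/lcmn_idPr/dvdnn.
Qed.

Lemma J1 p : J p 1 = 1%:M%R.
Proof. by apply/matrixP => i j; rewrite !ord1 !mxE eqxx. Qed.

Lemma singer_F2_1 (s : 'M['F_2]_1) : singer s -> s = J 2 1.
Proof.
move=> [_ sU ords]; rewrite J1; have : #[lin s] %| 1 by rewrite ords.
by move/order_lin_dvdP => /(_ sU); rewrite expr1.
Qed.

Lemma pure_jordan_cases p k d v (h : 'M['F_p]_d) :
    prime p -> h \in unitmx -> affsim (e_ p k 1) (J p k) v h ->
    [\/ k = 1, p = 2 /\ k \in [:: 2; 3; 4; 5] | p = 3 /\ k \in [:: 2; 3]] ->
  listed v h.
Proof.
move=> p_prime hU sim [k1 | [p2 kE] | [p3 kE]].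
- subst k; have p_bounds : p ^ 0 <= 1 < p ^ 1 by rewrite expn1 prime_gt1.
  have cl : classified (e_ p 1 1) (J p 1) p [:: p] by rewrite J1; apply: A3.
  apply: (pure_jordan_listed (e := 1) (e' := 0) p_prime _ p_bounds _ _ hU sim cl) => //.
  by rewrite expn1 expn0 muln1.
- subst p; move: kE; rewrite !inE => /or4P[] /eqP kE; subst k.
  + exact: (pure_jordan_listed (e := 2) (e' := 1) _ _ _ _ _ hU sim C9).
  + exact: (pure_jordan_listed (e := 2) (e' := 2) _ _ _ _ _ hU sim C3).
  + exact: (pure_jordan_listed (e := 3) (e' := 2) _ _ _ _ _ hU sim C14).
  exact: (pure_jordan_listed (e := 3) (e' := 3) _ _ _ _ _ hU sim C8).
subst p; move: kE; rewrite !inE => /orP[] /eqP kE; subst k.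
  exact: (pure_jordan_listed (e := 1) (e' := 1) _ _ _ _ _ hU sim C2).
exact: (pure_jordan_listed (e := 2) (e' := 1) _ _ _ _ _ hU sim C12).
Qed.

Lemma odd_exp2_sub1 m : 0 < m -> odd (2 ^ m - 1).
Proof. by move=> m0; rewrite oddB ?expn_gt0 // oddX gtn_eqF. Qed.

Lemma dvd3_exp2_sub1 m : 3 %| 2 ^ m - 1 -> ~~ odd m.
Proof.
apply: contraL => om; rewrite -eqn_mod_dvd ?expn_gt0 // -[m]odd_double_half om.
by rewrite expnS -mul2n expnM -modnMmr -modnXm exp1n.
Qed.

Lemma exp2_shift a m : 2 ^ (a + m) - 2 ^ a = 2 ^ a * (2 ^ m - 1).
Proof. by rewrite mulnBr muln1 -expnD. Qed.

Lemma perm_swap_middle (T : eqType) (x y : T) :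
  perm_eq [:: x; y; x; y] [:: x; x; y; y].
Proof. by rewrite perm_cons (perm_catCA [:: _] [:: _]). Qed.

(** There are p^(k-e) (i + 1) cycles, so k = 3 and k = 4 leave only i = 1, while k = 5 and p = 3
    with k > 1 are impossible. Over F_2 a Singer cycle of degree 1 is J_1, which gives the sporadic
    cases. *)
Lemma singer_sum_listed p k m i (s : 'M['F_p]_m) d v (h : 'M['F_p]_d) :
    prime p -> 0 < m -> 1 <= i <= 3 -> i %| p ^ m - 1 -> singer s ->
    perm_eq (cycle_lengths (lin (s ^+ i)%R)) (1 :: nseq i ((p ^ m - 1) %/ i)) ->
    h \in unitmx ->
    affsim (row_mx (e_ p k 1) 0%R) (dsum (J p k) (s ^+ i)%R) v h ->
    [\/ k = 1, p = 2 /\ k \in [:: 2; 3; 4; 5] | p = 3 /\ k \in [:: 2; 3]] ->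
    p ^ (k - (trunc_log p k).+1) * i.+1 <= 4 ->
  listed v h.
Proof.
move=> p_prime m_gt0 i13 dvd sing cyc hU sim cases le4.
have [_ sU _] := sing; have siU : (s ^+ i)%R \in unitmx by apply: unitmxX.
have p_gt1 := prime_gt1 p_prime; have i_gt0 : 0 < i by case/andP: i13.
have cL : all (coprime p) (1 :: nseq i ((p ^ m - 1) %/ i)).
  rewrite /= coprimen1 all_nseq; apply/orP; right.
  by apply: (coprime_dvdr (dvdn_div dvd)); apply: coprime_exp_sub1.
have self : affsim (e_ p (k + m) 1) (dsum (J p k) (s ^+ i)%R)
                   (row_mx (e_ p k 1) 0%R) (dsum (J p k) (s ^+ i)%R).
  rewrite e_row_mx; first exact: affsim_refl.
  by case: cases => [-> | [_] | [_]] //; rewrite !inE; lia.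
case: cases => [k1 | [p2 kE] | [p3 kE]].
- subst k; have cl := A4 (i := i) (s := s) _ i13 _ sing.
  rewrite /= addKn in cl; have {}cl := cl _ dvd.
  have p_bounds : p ^ 0 <= 1 < p ^ 1 by rewrite expn1 p_gt1.
  have {}cl := cl _; apply: (jordan_coprime_listed (e := 1) (e' := 0) p_prime _ p_bounds
    _ _ siU cyc hU sim self (cl _)) => //.
  + by rewrite expn1 expn0 muln1.
  by rewrite /= cats0 muln1 expn1 map_nseq muln_divA.
- subst p; move: kE; rewrite !inE => /or4P[] /eqP kE; subst k => //=.
  (* [i] divides the odd number 2^m - 1. *)
  + have i2 : i \in [:: 1; 3].
      case/andP: i13 => i1 i3; move: i_gt0 dvd; rewrite !inE.
      case: i i1 i3 {sim cyc cL le4 siU self} => [|[|[|[|]]]] // _ _ _.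
      by rewrite dvdn2 odd_exp2_sub1.
    have [m1 | m_gt1] := leqP m 1.
      have {m1}m1 : m = 1 by apply/eqP; rewrite eqn_leq m1.
      subst m; have i1 : i = 1 by apply/eqP; rewrite -dvdn1.
      subst i; have := singer_F2_1 sing => sE; subst s.
      exact: (jordan_coprime_listed (e := 2) (e' := 1) p_prime _ _ _ _ siU cyc hU sim self C11).
    have cl : classified (e_ 2 (2 + m) 1) (dsum (J 2 2) (s ^+ i)%R) 2
        (4 :: nseq i ((2 ^ (2 + m) - 4) %/ i)).
      apply: B5 => // i3; rewrite oddD /=; apply: dvd3_exp2_sub1.
      by rewrite -[X in X %| _]i3.
    apply: (jordan_coprime_listed (e := 2) (e' := 1) p_prime _ _ _ _ siU cyc hU sim self cl) => //.
    have e : 2 ^ (2 + m) - 4 = 4 * (2 ^ m - 1) := exp2_shift 2 m.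
    by rewrite e /= cats0 map_nseq muln_divA.
  + have i1 : i = 1 by move: le4; rewrite -[_ ^ _]/2; move: i_gt0; clear; lia.
    subst i; have [m1 | m_gt1] := leqP m 1.
      have {m1}m1 : m = 1 by apply/eqP; rewrite eqn_leq m1.
      subst m; have := singer_F2_1 sing => sE; subst s.
      exact: (jordan_coprime_listed (e := 2) (e' := 2) p_prime _ _ _ _ siU cyc hU sim self C6).
    have cl := B3 (_ : 5 <= 3 + m) sing.
    apply: (jordan_coprime_listed (e := 2) (e' := 2) p_prime _ _ _ _ siU cyc hU sim self (cl _)) => //.
    have e : 2 ^ (3 + m - 1) - 4 = 4 * (2 ^ m - 1) := exp2_shift 2 m.
    by rewrite e /= divn1; apply: perm_swap_middle.
  + have i1 : i = 1 by move: le4; rewrite -[_ ^ _]/2; move: i_gt0; clear; lia.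
    subst i; have [m1 | m_gt1] := leqP m 1.
      have {m1}m1 : m = 1 by apply/eqP; rewrite eqn_leq m1.
      subst m; have := singer_F2_1 sing => sE; subst s.
      exact: (jordan_coprime_listed (e := 3) (e' := 2) p_prime _ _ _ _ siU cyc hU sim self C15).
    have cl := B8 (_ : 6 <= 4 + m) sing.
    apply: (jordan_coprime_listed (e := 3) (e' := 2) p_prime _ _ _ _ siU cyc hU sim self (cl _)) => //.
    have e : 2 ^ (4 + m - 1) - 8 = 8 * (2 ^ m - 1) := exp2_shift 3 m.
    by rewrite e /= divn1; apply: perm_swap_middle.
  by move: le4; rewrite -[_ ^ _]/4; move: i_gt0; clear; lia.
subst p; move: kE; rewrite !inE => /orP[] /eqP kE; subst k.
  by move: le4; rewrite -[_ ^ _]/3; move: i_gt0; clear; lia.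
by move: le4; rewrite -[_ ^ _]/3; move: i_gt0; clear; lia.
Qed.

Lemma size_prod_lengths_nseq N q L :
  size (prod_lengths (nseq N q) L) = N * \sum_(l <- L) gcdn q l.
Proof. by rewrite size_prod_lengths big_nseq iter_addn_0 mulnC. Qed.

Lemma singer_pair_listed k a1 a2 (s1 : 'M['F_2]_a1) (s2 : 'M['F_2]_a2)
    d v (h : 'M['F_2]_d) :
    k \in [:: 1; 2] -> 0 < a1 -> a1 < a2 -> gcdn a1 a2 = 1 ->
    singer s1 -> singer s2 ->
    perm_eq (cycle_lengths (lin (dsum s1 s2)))
      [:: 1; 2 ^ a1 - 1; 2 ^ a2 - 1; (2 ^ a1 - 1) * (2 ^ a2 - 1)] ->
    h \in unitmx ->
    affsim (row_mx (e_ 2 k 1) 0%R) (dsum (J 2 k) (dsum s1 s2)) v h ->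
  listed v h.
Proof.
move=> k12 a1_gt0 lt_a gcd1 sing1 sing2 cyc hU sim.
have [_ s1U _] := sing1; have [_ s2U _] := sing2.
have sU : dsum s1 s2 \in unitmx by rewrite unitmx_dsum s1U.
have k_gt0 : 0 < k by move: k12; rewrite !inE; lia.
have a2_gt0 : 0 < a2 by apply: leq_ltn_trans lt_a.
have assoc := affsim_dsumA (e_ 2 k 1) (J 2 k) s1 s2.
rewrite !e_row_mx ?addn_gt0 ?k_gt0 // in assoc sim.
have cL : all (coprime 2) [:: 1; 2 ^ a1 - 1; 2 ^ a2 - 1; (2 ^ a1 - 1) * (2 ^ a2 - 1)].
  by rewrite /= !coprime2n oddM !odd_exp2_sub1.
rewrite -e_row_mx // in sim assoc.
move: k12; rewrite !inE => /orP[] /eqP k12; subst k.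
  have [a1E | a1_gt1] := leqP a1 1.
    have {}a1E : a1 = 1 by apply/eqP; rewrite eqn_leq a1E.
    subst a1; have := singer_F2_1 sing1 => sE; subst s1.
    have cl := B4 (_ : 4 <= 1 + 1 + a2) sing2.
    apply: (jordan_coprime_listed (e := 1) (e' := 0) _ _ _ _ _ sU cyc hU sim assoc (cl _)) => //.
    have e : 2 ^ (1 + 1 + a2 - 1) - 2 = 2 * (2 ^ a2 - 1) := exp2_shift 1 a2.
    by rewrite e /= -[2 ^ 1 - 1]/1 mul1n.
  have cl := B7 (_ : 6 <= 1 + a1 + a2) _ a1_gt1 lt_a gcd1 sing1 sing2.
  apply: (jordan_coprime_listed (e := 1) (e' := 0) _ _ _ _ _ sU cyc hU sim assoc (cl _ _)) => //.
    by move: a1_gt1 lt_a; lia.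
  by rewrite /= !mulnA.
have [a1E | a1_gt1] := leqP a1 1.
  have {}a1E : a1 = 1 by apply/eqP; rewrite eqn_leq a1E.
  subst a1; have := singer_F2_1 sing1 => sE; subst s1.
  have cl := B6 (_ : 5 <= 2 + 1 + a2) sing2.
  apply: (jordan_coprime_listed (e := 2) (e' := 1) _ _ _ _ _ sU cyc hU sim assoc (cl _)) => //.
  have e : 2 ^ (2 + 1 + a2 - 1) - 4 = 4 * (2 ^ a2 - 1) := exp2_shift 2 a2.
  by rewrite e /= -[2 ^ 1 - 1]/1 mul1n.
have cl := B7 (_ : 6 <= 2 + a1 + a2) _ a1_gt1 lt_a gcd1 sing1 sing2.
apply: (jordan_coprime_listed (e := 2) (e' := 1) _ _ _ _ _ sU cyc hU sim assoc (cl _ _)) => //.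
  by move: a1_gt1 lt_a; lia.
by rewrite /= !mulnA.
Qed.

(** C4 translates along its last block, so the Jordan block split off has to be moved to the end. *)
Lemma e_last : e_ 2 3 3 = row_mx (0%R : 'rV_2) (e_ 2 1 1).
Proof.
apply/rowP => j; rewrite !mxE; case: splitP => i eq_j; rewrite !mxE eq_j.
  by rewrite eqSS ltn_eqF.
by rewrite ord1.
Qed.

Lemma scaled_J2_listed k (s : 'M['F_2]_1) d v (h : 'M['F_2]_d) :
    k \in [:: 1; 2] -> singer s ->
    perm_eq (cycle_lengths (lin (s *t J 2 2)%R)) [:: 1; 2 - 1; 2 * (2 - 1)] ->
    h \in unitmx ->
    affsim (row_mx (e_ 2 k 1) 0%R) (dsum (J 2 k) (s *t J 2 2)%R) v h ->
  listed v h.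
Proof.
move=> k12 /singer_F2_1-> cyc hU sim.
have sJ : (J 2 1 *t J 2 2)%R = J 2 2 :> 'M_2.
  by rewrite J1 tens_scalar1mx; apply: castmx_id.
rewrite sJ in cyc sim; have JU := J_unit (isT : prime 2) 2.
have ord2 : #[lin (J 2 2)] = 2 by rewrite (order_cycle_lengths cyc) !big_cons big_nil.
move: k12; rewrite !inE => /orP[] /eqP k12; subst k.
  have swap := affsim_dsumC (e_ 2 1 1) (J 2 1) (J 2 2); rewrite -e_last in swap.
  apply: (jordan_sum_listed (e := 1) (e' := 0) _ _ _ _ _ JU cyc hU sim swap C4) => //.
  by rewrite ord2.
have self := affsim_refl (row_mx (e_ 2 2 1) 0%R) (dsum (J 2 2) (J 2 2)).
rewrite {1}e_row_mx // in self.
apply: (jordan_sum_listed (e := 2) (e' := 1) _ _ _ _ _ JU cyc hU sim self C13a) => //.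
by rewrite ord2.
Qed.

(** The last hypothesis bounds the number of cycles of t_{e_1}(J_k + h0). Lengths divisible by [p]
    make the sum of gcds large, which excludes most of the linear list. *)
Lemma jordan_sum_lin_class p k n (h0 : 'M['F_p]_n) L d v (h : 'M['F_p]_d) :
    prime p -> 0 < k -> 0 < n -> lin_class h0 L ->
    perm_eq (cycle_lengths (lin h0)) L -> h \in unitmx ->
    affsim (row_mx (e_ p k 1) 0%R) (dsum (J p k) h0) v h ->
    p ^ (k - (trunc_log p k).+1) *
      (\sum_(l <- L) gcdn (p ^ (trunc_log p k).+1) l) <= 4 ->
  listed v h.
Proof.
move=> p_prime k_gt0 n_gt0 cl cyc hU sim le4; have p_gt1 := prime_gt1 p_prime.
set e := (trunc_log p k).+1 in le4 *.
have N_gt0 : 0 < p ^ (k - e) by rewrite expn_gt0 prime_gt0.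
have cases : 0 < \sum_(l <- L) gcdn (p ^ e) l ->
    [\/ k = 1, p = 2 /\ k \in [:: 2; 3; 4; 5] | p = 3 /\ k \in [:: 2; 3]].
  move=> s_gt0; apply: small_jordan_blocks => //; apply: leq_trans le4.
  by apply: leq_pmulr.
(* A sum above 2 forces p^(k-e) = 1, which for p = 2 means k = 1 or k = 2. *)
have k12 : p = 2 -> 2 < \sum_(l <- L) gcdn (p ^ e) l -> k \in [:: 1; 2].
  move=> p2 s_gt2; case: cases => [|->//|[_]|[p3]]; last by rewrite p3 in p2.
    by apply: ltn_trans s_gt2.
  rewrite !inE => /or4P[] /eqP kE //; move: le4; rewrite /e p2 kE;
    by move: s_gt2; rewrite /e p2 kE; move: (\sum_(l <- L) _) => x; rewrite -?[_ ^ _]/2 -?[_ ^ _]/4; lia.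
case: n h0 L / cl n_gt0 cyc sim le4 cases k12.
- move=> m i s m_gt0 i13 dvd sing _ cyc sim le4 cases _.
  have sumE : \sum_(l <- 1 :: nseq i ((p ^ m - 1) %/ i)) gcdn (p ^ e) l = i.+1.
    rewrite big_cons gcdn1 big_nseq iter_addn_0 add1n (eqP (_ : coprime _ _)) ?mul1n //.
    by rewrite coprimeXl // (coprime_dvdr (dvdn_div dvd)) // coprime_exp_sub1.
  rewrite sumE in le4 cases.
  exact: (singer_sum_listed p_prime m_gt0 i13 dvd sing cyc hU sim (cases isT) le4).
- move=> s sing _ cyc sim le4 _ k12.
  (* The gcds are 1, at least 1 and at least [p], so p + 2 <= 4. *)
  have p2 : p = 2.
    have dvdp : p %| gcdn (p ^ e) (p * (p - 1)).
      by rewrite dvdn_gcd dvdn_mulr // /e expnS dvdn_mulr.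
    have g_gt0 x : 0 < gcdn (p ^ e) x by rewrite gcdn_gt0 expn_gt0 prime_gt0.
    have le_p := dvdn_leq (g_gt0 _) dvdp.
    move: le4 N_gt0 (g_gt0 (p - 1)) le_p p_gt1; rewrite !big_cons big_nil gcdn1 addn0.
    move: (gcdn _ (p - 1)) (gcdn _ (p * _)) (p ^ (k - e)); clear => x y N; nia.
  subst p; apply: (scaled_J2_listed _ sing cyc hU sim); apply: k12 => //.
  rewrite !big_cons big_nil gcdn1 addn0 /e expnS.
  by rewrite (_ : gcdn _ (2 * (2 - 1)) = 2) //; apply/gcdn_idPr; rewrite dvdn_mulr.
- move=> a1 a2 s1 s2 p2 a3 gcd1 sing1 sing2 n_gt0 cyc sim le4 _ k12; subst p.
  have [a1_gt0 s1U _] := sing1; have [a2_gt0 s2U _] := sing2.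
  have {}k12 : k \in [:: 1; 2].
    apply: k12 => //; have co x : odd x -> gcdn (2 ^ e) x = 1.
      by rewrite -coprime2n => /(coprimeXl e)/eqP.
    by rewrite !big_cons big_nil !co // ?oddM ?odd_exp2_sub1.
  have [lt_a | lt_a | eq_a] := ltngtP a1 a2.
  + exact: (singer_pair_listed k12 a1_gt0 lt_a gcd1 sing1 sing2 cyc hU sim).
  + have swap : lsim (dsum s2 s1) (dsum s1 s2).
      exact: (affsim_lsim (affsim_dsumC 0%R s1 s2)).
    have sU : dsum s1 s2 \in unitmx by rewrite unitmx_dsum s1U.
    apply: (singer_pair_listed k12 a2_gt0 lt_a _ sing2 sing1 _ hU).
    * by rewrite gcdnC.
    * rewrite perm_sym in cyc; rewrite perm_sym.
      apply: perm_trans (perm_trans cyc (lsim_cycles sU swap)).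
      by rewrite perm_cons (perm_catCA [:: _] [:: _]) mulnC.
    exact: affsim_trans (affsim_dsum _ _ swap) sim.
  by move: gcd1 a3; rewrite eq_a gcdnn; lia.
(* The gcds with 1, 1, 2, 4 add up to at least 1 + 1 + 2 + 2. *)
- move=> p2 _ _ _ le4; subst p; exfalso; move: le4 N_gt0.
  have g2 : gcdn (2 ^ e) 2 = 2 by apply/gcdn_idPr; rewrite /e expnS dvdn_mulr.
  have g4 : 2 <= gcdn (2 ^ e) 4.
    by rewrite dvdn_leq ?gcdn_gt0 ?orbT // dvdn_gcd /e expnS dvdn_mulr.
  rewrite !big_cons big_nil !gcdn1 g2; move: (gcdn _ 4) (2 ^ (k - e)) g4; clear.
  by move=> x N; nia.
(* The gcds with 1, 3, 6, 6 add up to at least 1 + 1 + 2 + 2. *)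
move=> s p2 _ _ _ _ le4; subst p; exfalso; move: le4 N_gt0.
have g6 : 2 <= gcdn (2 ^ e) 6.
  by rewrite dvdn_leq ?gcdn_gt0 ?orbT // dvdn_gcd /e expnS dvdn_mulr.
have g3 : 0 < gcdn (2 ^ e) 3 by rewrite gcdn_gt0 orbT.
rewrite !big_cons big_nil !gcdn1; move: (gcdn _ 6) (gcdn _ 3) (2 ^ (k - e)) g6 g3; clear.
by move=> x y N; nia.
Qed.

Theorem theorem1p5 (p d : nat) (p_prime : prime p) (d_gt0 : (0 < d)%N)
    (v : 'rV['F_p]_d) (h : 'M['F_p]_d) (h_unit : h \in unitmx)
    (g : {perm 'rV['F_p]_d}) (g_def : g = (transl v * lin h)%g) :
  (#|porbits g| <= 4)%N ->
  exists (v0 : 'rV['F_p]_d) (h0 : 'M['F_p]_d) (c : nat) (l : seq nat),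
    [/\ classified v0 h0 c l,
        g \in ((transl v0 * lin h0) ^: AGL p d)%g,
        #[g]%g = (c * #[lin h]%g)%N &
        perm_eq (cycle_lengths g) l].
Proof.
rewrite {}g_def -size_cycle_lengths => few; rewrite -/(listed v h).
have [k [m [h' sim]]] := jordan_splitting v h.
have := affsim_unit sim; rewrite h_unit unitmx_dsum => /andP[JU h'U].
have km : k + m = d by have [P [x0 []]] := sim.
have cyc := affsim_cycles h_unit sim.
have [k0 | k_gt0] := posnP k.
  subst k; have sim0 : affsim 0%R h' v h.
    apply: affsim_trans sim; rewrite [e_ _ _ _]thinmx0 row_mx0.
    have swap := affsim_dsumC (0%R : 'rV_0) (J p 0) h'.
    have pad := affsim_dsum0 (0%R : 'rV_m) h' (J p 0).
    by rewrite !row_mx0 in swap pad; apply: affsim_trans pad swap.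
  have cyc0 := affsim_cycles h_unit sim0; rewrite transl0 mul1g in cyc0.
  have m_gt0 : 0 < m by rewrite -[m]add0n km.
  have few' : #|porbits (lin h')| <= 4 by rewrite -size_cycle_lengths -(perm_size cyc0).
  have [n [h0 [l [cl sim1 cyc1]]]] := linear_classification p_prime m_gt0 h'U few'.
  apply: (classified_listed h_unit (lin_class_classified cl)).
  - exact: affsim_trans (lsim_affsim sim1) sim0.
  - by rewrite transl0 !mul1g mul1n.
  rewrite transl0 mul1g; apply: perm_trans cyc1; rewrite perm_sym.
  exact: lsim_cycles.
have bounds : p ^ (trunc_log p k).+1.-1 <= k < p ^ (trunc_log p k).+1.
  exact: trunc_log_bounds (prime_gt1 p_prime) k_gt0.
have cycJ := transl_J_cycles p_prime k_gt0 bounds.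
have cyc' : perm_eq (cycle_lengths (transl 0%R * lin h')%g) (cycle_lengths (lin h')).
  by rewrite transl0 mul1g.
have {cyc cyc'}cyc := perm_trans cyc (affine_dsum_cycles JU h'U cycJ cyc').
rewrite (perm_size cyc) in few.
set N := p ^ (k - (trunc_log p k).+1) in few cyc.
set q := p ^ (trunc_log p k).+1 in few cyc.
have N_gt0 : 0 < N by rewrite expn_gt0 prime_gt0.
(* Every pair of cycles contributes at least one cycle to the product. *)
have le_N : N * #|porbits (lin h')| <= 4.
  apply: leq_trans few; rewrite -size_cycle_lengths -{1}(size_nseq N q).
  by apply: leq_size_prod_lengths; rewrite all_nseq expn_gt0 prime_gt0 ?orbT.
have orb_gt0 : 0 < #|porbits (lin h')|.
  by apply/card_gt0P; exists (porbit (lin h') 0%R); apply: imset_f.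
have [m0 | m_gt0] := posnP m.
  subst m; apply: (pure_jordan_cases p_prime h_unit (affsim_trans (affsim_dsum0 _ _ _) sim)).
  apply: small_jordan_blocks => //; apply: leq_trans le_N; exact: leq_pmulr.
have few' : #|porbits (lin h')| <= 4 by apply: leq_trans le_N; apply: leq_pmull.
have [n [h0 [l [cl sim1 cyc1]]]] := linear_classification p_prime m_gt0 h'U few'.
apply: (jordan_sum_lin_class p_prime k_gt0 _ cl _ h_unit (affsim_trans (affsim_dsum _ _ sim1) sim)).
- by have [P [nm _ _]] := sim1; rewrite nm.
- by apply: perm_trans cyc1; rewrite perm_sym; apply: lsim_cycles.
by rewrite -size_prod_lengths_nseq (perm_size (prod_lengths_perm (perm_refl _) cyc1)) in few *.
Qed.
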